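(* Let $K$ be a field of characteristic zero and $n\ge1$. The following are equivalent: the algebra $\mathbb{I}_n$ is a left coherent algebra; the algebra $\mathbb{I}_n$ is a right coherent algebra; $n=1$.
   Context: $\mathbb{I}_n=K\langle x_1,\ldots,x_n,\partial_1,\ldots,\partial_n,\int_1,\ldots,\int_n\rangle$ is the subalgebra of $\mathrm{End}_K(K[x_1,\ldots,x_n])$ generated by the multiplications by $x_i$, the partial derivatives $\partial_i=\partial/\partial x_i$ and the integrations $\int_i$, i.e. the $K$-linear maps $x_1^{\alpha_1}\cdots x_n^{\alpha_n}\mapsto(\alpha_i+1)^{-1}x_i\,x_1^{\alpha_1}\cdots x_n^{\alpha_n}$. A module $M$ over a ring $R$ is finitely presented if there is an exact sequence of modules $R^m\to R^k\to M\to0$ with $m,k\in\mathbb{N}$. A finitely generated module is coherent if each of its finitely generated submodules is finitely presented. A ring $R$ is left (resp. right) coherent if the module ${}_RR$ (resp. $R_R$) is coherent. *)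

(* Defs.v *)
From HB Require Import structures.
From mathcomp Require Import all_boot all_algebra.
From mathcomp Require Import boolp ssrcomplements.
From mathcomp Require Export mpoly.

Set Implicit Arguments.
Unset Strict Implicit.
Unset Printing Implicit Defensive.

Import GRing.Theory.
Local Open Scope ring_scope.

(* An [lmodType R] is a left R-module.  A right R-module is an
   [lmodType R^c], where [R^c] is the converse ring of R. *)

Section Coherence.
Variable R : pzRingType.

(* By [asbool] every subset of M is a [{pred M}], so [submodClosed M] ranges over
   all the submodules of M. *)
Definition submod_type (M : lmodType R) (N : submodClosed M) : Type :=
  {x : M | x \in N}.

HB.instance Definition _ (M : lmodType R) (N : submodClosed M) :=
  SubChoice.on (submod_type N).
HB.instance Definition _ (M : lmodType R) (N : submodClosed M) :=
  [SubChoice_isSubLmodule of submod_type N by <:].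

Definition finitely_generated (M : lmodType R) : Prop :=
  exists (k : nat) (e : 'I_k -> M),
    forall x : M, exists c : 'I_k -> R, x = \sum_(i < k) c i *: e i.

(* R^m --f--> R^k --g--> M --> 0 is exact *)
Definition finitely_presented (M : lmodType R) : Prop :=
  exists (m k : nat) (f : {linear 'rV[R]_m -> 'rV[R]_k})
         (g : {linear 'rV[R]_k -> M}),
    (forall y : M, exists x, g x = y) /\
    (forall x, g x = 0 <-> exists z, f z = x).

Definition coherent_module (M : lmodType R) : Prop :=
  finitely_generated M /\
  forall N : submodClosed M,
    finitely_generated (submod_type N) -> finitely_presented (submod_type N).

End Coherence.

Definition left_coherent (R : pzRingType) : Prop := @coherent_module R R^o.
Definition right_coherent (R : pzRingType) : Prop := @coherent_module R^c (R^c)^o.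

Section GeneratedSubalgebra.
Variables (K : comNzRingType) (A : algType K) (G : A -> Prop).

Definition subalg_gen : {pred A} := fun a =>
  `[< forall S : subalgClosed A, (forall g, G g -> g \in S) -> a \in S >].

Lemma subalg_gen_closed : subalg_closed subalg_gen.
Proof.
split=> [|c u v|u v].
- by apply/asboolP => S _; apply: rpred1.
- move=> /asboolP uS /asboolP vS; apply/asboolP => S GS.
  by apply: rpredD; [apply/rpredZ/uS | apply: vS].
- move=> /asboolP uS /asboolP vS; apply/asboolP => S GS.
  by apply: rpredM; [apply: uS | apply: vS].
Qed.

HB.instance Definition _ := GRing.isSubalgClosed.Build K A subalg_gen
  subalg_gen_closed.

Definition subalg_gen_type : Type := {a : A | a \in subalg_gen}.

HB.instance Definition _ := SubChoice.on subalg_gen_type.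
HB.instance Definition _ := [SubChoice_isSubAlgebra of subalg_gen_type by <:].

End GeneratedSubalgebra.

(* The K-algebra End_K(K[x_1, ..., x_n]), with composition as product:
   (f * g) p = f (g p). *)
Section PolyEnd.
Variables (K : comNzRingType) (n : nat).

Definition polyEnd : Type := {linear {mpoly K[n]} -> {mpoly K[n]}}.

Definition polyEnd_fun (f : polyEnd) : {mpoly K[n]} -> {mpoly K[n]} := f.
Coercion polyEnd_fun : polyEnd >-> Funclass.

HB.instance Definition _ := gen_eqMixin polyEnd.
HB.instance Definition _ := gen_choiceMixin polyEnd.

Implicit Types f g h : polyEnd.

Lemma polyEndP f g : (f =1 g) <-> (f = g).
Proof.
split=> [|-> //] /funext; case: f => f [[f1] [f2]]; case: g => g [[g1] [g2]].
rewrite /polyEnd_fun /= => fg; move: fg f1 f2 g1 g2 => -> f1 f2 g1 g2.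
by rewrite (Prop_irrelevance f1 g1) (Prop_irrelevance f2 g2).
Qed.

Definition pe0 : polyEnd :=
  GRing.Linear.clone K _ _ _ (\0 : {mpoly K[n]} -> {mpoly K[n]}) _.
Definition peD f g : polyEnd :=
  GRing.Linear.clone K _ _ _ (f \+ g : {mpoly K[n]} -> {mpoly K[n]}) _.
Definition peN f : polyEnd :=
  GRing.Linear.clone K _ _ _ (\- f : {mpoly K[n]} -> {mpoly K[n]}) _.
Definition pe1 : polyEnd :=
  GRing.Linear.clone K _ _ _ (idfun : {mpoly K[n]} -> {mpoly K[n]}) _.
Definition peM f g : polyEnd :=
  GRing.Linear.clone K _ _ _ (f \o g : {mpoly K[n]} -> {mpoly K[n]}) _.
Definition peZ (a : K) f : polyEnd :=
  GRing.Linear.clone K _ _ _ (a \*: f : {mpoly K[n]} -> {mpoly K[n]}) _.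

Fact peDA : associative peD.
Proof. by move=> f g h; apply/polyEndP => p; apply: addrA. Qed.
Fact peDC : commutative peD.
Proof. by move=> f g; apply/polyEndP => p; apply: addrC. Qed.
Fact pe0D : left_id pe0 peD.
Proof. by move=> f; apply/polyEndP => p; apply: add0r. Qed.
Fact peND : left_inverse pe0 peN peD.
Proof. by move=> f; apply/polyEndP => p; apply: addNr. Qed.

HB.instance Definition _ := GRing.isZmodule.Build polyEnd peDA peDC pe0D peND.

Fact peMA : associative peM.
Proof. by move=> f g h; apply/polyEndP. Qed.
Fact pe1M : left_id pe1 peM.
Proof. by move=> f; apply/polyEndP. Qed.
Fact peM1 : right_id pe1 peM.
Proof. by move=> f; apply/polyEndP. Qed.
Fact peMDl : left_distributive peM +%R.
Proof. by move=> f g h; apply/polyEndP. Qed.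
Fact peMDr : right_distributive peM +%R.
Proof. by move=> f g h; apply/polyEndP => p; apply: raddfD. Qed.
Fact pe1_neq0 : pe1 != 0.
Proof. by apply/eqP => /polyEndP /(_ 1) /eqP; rewrite oner_eq0. Qed.

HB.instance Definition _ := GRing.Zmodule_isNzRing.Build polyEnd
  peMA pe1M peM1 peMDl peMDr pe1_neq0.

Fact peZA a b f : peZ a (peZ b f) = peZ (a * b) f.
Proof. by apply/polyEndP => p; apply: scalerA. Qed.
Fact pe1Z : left_id 1 peZ.
Proof. by move=> f; apply/polyEndP => p; apply: scale1r. Qed.
Fact peZDr : right_distributive peZ +%R.
Proof. by move=> a f g; apply/polyEndP => p; apply: scalerDr. Qed.
Fact peZDl f : {morph peZ^~ f : a b / a + b}.
Proof. by move=> a b; apply/polyEndP => p; apply: scalerDl. Qed.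

HB.instance Definition _ := GRing.Zmodule_isLmodule.Build K polyEnd
  peZA pe1Z peZDr peZDl.

Fact peZAl (a : K) f g : a *: (f * g) = (a *: f) * g.
Proof. by apply/polyEndP. Qed.
HB.instance Definition _ := GRing.Lmodule_isLalgebra.Build K polyEnd peZAl.

Fact peZAr (a : K) f g : a *: (f * g) = f * (a *: g).
Proof. by apply/polyEndP => p; apply: esym; apply: linearZ. Qed.
HB.instance Definition _ := GRing.Lalgebra_isAlgebra.Build K polyEnd peZAr.

End PolyEnd.

Section IntegroDifferential.
Variables (K : fieldType) (n : nat).

(* Extends linearly the values of lemma [mpoly_intX] on monomials. *)
Definition mpoly_int (i : 'I_n) (p : {mpoly K[n]}) : {mpoly K[n]} :=
  \sum_(m <- msupp p) p@_m *: (((m i).+1%:R)^-1 *: ('X_i * 'X_[m])).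

Lemma mpoly_int_is_linear i : linear (mpoly_int i).
Proof.
have wE (p : {mpoly K[n]}) k : (msize p <= k)%N -> mpoly_int i p =
    \sum_(m : 'X_{1..n < k}) p@_m *: (((m i).+1%:R)^-1 *: ('X_i * 'X_[m])).
  pose I : subFinType _ := 'X_{1..n < k}.
  move=> le_pk; rewrite /mpoly_int (big_mksub I) /=; first last.
  - by move=> x /msize_mdeg_lt/leq_trans/(_ le_pk).
  - by rewrite msupp_uniq.
  rewrite big_rmcond //= => j /memN_msupp_eq0 ->.
  by rewrite scale0r.
move=> c p q; pose k := (msize p + msize q + msize (c *: p + q))%N.
have kp : (msize p <= k)%N by rewrite /k -addnA leq_addr.
have kq : (msize q <= k)%N by rewrite /k addnAC leq_addl.
have kr : (msize (c *: p + q) <= k)%N by rewrite leq_addl.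
rewrite !(wE _ k) //.
rewrite scaler_sumr -big_split /=; apply: eq_bigr => m _.
by rewrite mcoeffD mcoeffZ scalerDl -scalerA.
Qed.

HB.instance Definition _ i := GRing.isLinear.Build K {mpoly K[n]} {mpoly K[n]}
  _ (mpoly_int i) (mpoly_int_is_linear i).

Lemma mpoly_intX i m :
  mpoly_int i 'X_[m] = ((m i).+1%:R)^-1 *: ('X_i * 'X_[m]).
Proof. by rewrite /mpoly_int msuppX big_seq1 mcoeffX eqxx scale1r. Qed.

Definition mpoly_mulX (i : 'I_n) (p : {mpoly K[n]}) : {mpoly K[n]} := 'X_i * p.

Lemma mpoly_mulX_is_linear i : linear (mpoly_mulX i).
Proof. by move=> c p q; rewrite /mpoly_mulX mulrDr scalerAr. Qed.

HB.instance Definition _ i := GRing.isLinear.Build K {mpoly K[n]} {mpoly K[n]}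
  _ (mpoly_mulX i) (mpoly_mulX_is_linear i).

Definition op_x (i : 'I_n) : polyEnd K n :=
  GRing.Linear.clone K _ _ _ (mpoly_mulX i) _.
Definition op_d (i : 'I_n) : polyEnd K n :=
  GRing.Linear.clone K _ _ _ (mderiv i) _.
Definition op_int (i : 'I_n) : polyEnd K n :=
  GRing.Linear.clone K _ _ _ (mpoly_int i) _.

Definition II_generator (f : polyEnd K n) : Prop :=
  exists i : 'I_n, [\/ f = op_x i, f = op_d i | f = op_int i].

(* The algebra I_n. *)
Definition II : algType K := subalg_gen_type II_generator.

End IntegroDifferential.

(* Main.v *)
From HB Require Import structures.
Require Import Defs.
From mathcomp Require Import all_boot all_algebra.
From mathcomp Require Import boolp zify.

(** Write D for the derivative in one variable, J for the integration in it and
    theta = x D, which multiplies x^j by j.  Everything rests on the relations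
    D J = 1, p(theta) D = D p(theta - 1), J p(theta) = p(theta - 1) J, and on the
    idempotent e = 1 - J D, the projection onto the constants in that variable,
    on which p(theta) acts as p(0).  They are collected in [shift_pair].
    Exchanging D and J turns them into the same relations in the converse ring,
    so each statement about left ideals yields its right-hand twin
    ([shift_pair_conv], [spanned_conv]).

    One variable.  The ring R is spanned by the J^i p(theta) D^j.  Let F be the
    ideal of the elements a such that D^n a = 0 for some n: these are the operators of
    finite rank, and R / F is the ring of skew Laurent polynomials in D over
    K[theta], a left Noetherian domain.  Coherence does not follow from this
    alone, because F is not finitely generated.  Let S be the module of left
    syzygies of a_1, ..., a_k.
    - Modulo F^k, S is finitely generated, by the Hilbert basis argument
      ([left_ideal_fin_gen_mod]) applied to one coordinate after the other
      ([submod_row_fin_gen_mod]).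
    - A row of S with entries in F is a left combination of rows of S with
      entries in e R ([torsion_row_gen]).  The space e R has the basis e D^j and
      is identified with K[X].  On it an element a outside F acts from the right
      by shifting all large degrees by a constant ([Psi_size]), so that
      e R / e R a is finite dimensional ([Psi_reduce]).
    - If some a_i lies outside F, then modulo F it has a common left multiple
      with each a_j ([Ore_mod_torsion]).  This produces syzygies whose j-th
      coordinate lies outside F and whose other coordinates, except the i-th,
      vanish.  Subtracting left multiples of them from a row of S with entries
      in e R bounds the degree of its coordinates other than the i-th, and then
      also that of the i-th.  If all the a_i lie in F, rows with a single
      nonzero coordinate D^n do the same.  What remains is a finite dimensional
      vector space.
    Hence S is finitely generated ([syzygy_fin_gen]).

    Several variables.  In a left coherent ring the left annihilator of an
    element is finitely generated ([annihilator_fin_gen]).  Consider the left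
    annihilator of theta_1 - theta_2.  Each b in it satisfies b J_1^n = 0 for
    some n ([annihilator_J]), so finitely many elements of it, and the left
    ideal that they generate, are killed by one power of J_1 on the right.  But
    e_1 D_1^n e_2 D_2^n lies in the annihilator and is not killed by J_1^n. *)

Set Implicit Arguments.
Unset Strict Implicit.
Unset Printing Implicit Defensive.

Import GRing.Theory.
Local Open Scope ring_scope.

(** * Finite generation, syzygies and coherence *)

Section Generation.
Variables (R : pzRingType) (V : lmodType R).
Implicit Types (S T P : V -> Prop) (l : seq V) (x y : V).

Definition submodule P : Prop :=
  P 0 /\ forall (a : R) x y, P x -> P y -> P (a *: x + y).

(** Impredicative, so that membership is proved and used by induction; [gen_comb]
    gives the explicit linear combinations. *)
Definition gen l x : Prop :=
  forall P, submodule P -> (forall y, y \in l -> P y) -> P x.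

(** Taking for [T] the rows with entries in an ideal replaces a passage to the
    quotient module. *)
Definition fin_gen_mod S T : Prop :=
  exists l, (forall x, x \in l -> S x) /\
    forall x, S x -> exists y, gen l y /\ T (x - y).

Definition fin_gen S : Prop := fin_gen_mod S (fun x => x = 0).

Lemma gen_submod l : submodule (gen l).
Proof.
split=> [P [] //|a x y gx gy P sP lP].
by case: (sP) => _; apply; [apply: gx | apply: gy].
Qed.

Lemma gen_mem l x : x \in l -> gen l x.
Proof. by move=> lx P _; apply. Qed.

Lemma gen_in l S x : submodule S -> (forall y, y \in l -> S y) -> gen l x -> S x.
Proof. by move=> sS lS; apply. Qed.

Lemma gen_trans l l' x : (forall y, y \in l -> gen l' y) -> gen l x -> gen l' x.
Proof. by apply: gen_in; apply: gen_submod. Qed.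

Lemma submod0 P : submodule P -> P 0. Proof. by case. Qed.

Lemma submodD P x y : submodule P -> P x -> P y -> P (x + y).
Proof. by case=> _ sP Px Py; rewrite -[x]scale1r; apply: sP. Qed.

Lemma submodZ P a x : submodule P -> P x -> P (a *: x).
Proof. by case=> P0 sP Px; rewrite -[_ *: _]addr0; apply: sP. Qed.

Lemma submodB P x y : submodule P -> P x -> P y -> P (x - y).
Proof.
by move=> sP Px Py; apply: submodD => //; rewrite -scaleN1r; apply: submodZ.
Qed.

Lemma submod_sum P (I : Type) (r : seq I) (Q : pred I) (F : I -> V) :
  submodule P -> (forall i, Q i -> P (F i)) -> P (\sum_(i <- r | Q i) F i).
Proof.
move=> sP PF; apply: (big_ind P) => //; first exact: submod0.
by move=> x y; apply: submodD.
Qed.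

(** The generators in the second hypothesis are only asked to lie in [S]: the
    elements of [S] satisfying [T] may be reached from generators outside [T]. *)
Lemma fin_gen_mod_trans S T T' : submodule S -> fin_gen_mod S T ->
  (exists l, (forall x, x \in l -> S x) /\
    forall x, S x -> T x -> exists y, gen l y /\ T' (x - y)) ->
  fin_gen_mod S T'.
Proof.
move=> sS [l [lS lST]] [l' [lS' lST']].
exists (l ++ l'); split=> [x|x Sx].
  by rewrite mem_cat => /orP [/lS //|/lS'].
have [y [gy Ty]] := lST x Sx.
have [z [gz Tz]] : exists z, gen l' z /\ T' (x - y - z).
  by apply: lST' => //; apply: submodB => //; exact: gen_in gy.
exists (y + z); split; last by rewrite opprD addrA.
apply: (submodD (gen_submod _)).
  by apply: gen_trans gy => w lw; apply: gen_mem; rewrite mem_cat lw.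
by apply: gen_trans gz => w lw; apply: gen_mem; rewrite mem_cat lw orbT.
Qed.

Lemma gen_comb l x :
  gen l x -> exists c : 'I_(size l) -> R, x = \sum_i c i *: l`_i.
Proof.
pose P x := exists c : 'I_(size l) -> R, x = \sum_i c i *: l`_i.
apply: (gen_in (S := P)); first split.
- by exists (fun _ => 0); rewrite big1 // => i _; rewrite scale0r.
- move=> a _ _ [c ->] [d ->]; exists (fun i => a * c i + d i).
  by rewrite scaler_sumr -big_split; apply: eq_bigr => i _; rewrite scalerDl scalerA.
- move=> y ly; have iy : (index y l < size l)%N by rewrite index_mem.
  exists (fun i => (i == Ordinal iy)%:R).
  rewrite (bigD1 (Ordinal iy)) //= eqxx scale1r nth_index // big1 ?addr0 //.
  by move=> i /negPf ->; rewrite scale0r.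
Qed.

End Generation.

Arguments gen_mem {R V l x}.

Section CoherenceCriteria.
Variable R : pzRingType.

Definition row_comb (V : lmodType R) (k : nat) (v : 'I_k -> V) (s : 'rV[R]_k) : V :=
  \sum_i s 0 i *: v i.

Lemma row_comb_linear (V : lmodType R) k (v : 'I_k -> V) : linear (row_comb v).
Proof.
move=> a s t; rewrite /row_comb scaler_sumr -big_split /=.
by apply: eq_bigr => i _; rewrite !mxE scalerDl scalerA.
Qed.

HB.instance Definition _ (V : lmodType R) k (v : 'I_k -> V) :=
  GRing.isLinear.Build R 'rV[R]_k V _ (row_comb v) (row_comb_linear v).

Lemma row_combE (V : lmodType R) k (g : {linear 'rV[R]_k -> V}) s :
  g s = row_comb (fun i => g (delta_mx 0 i)) s.
Proof.
by rewrite {1}[s]row_sum_delta linear_sum; apply: eq_bigr => i _; rewrite linearZ.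
Qed.

Definition syzygy k (a : 'I_k -> R) (s : 'rV[R]_k) : Prop :=
  \sum_i s 0 i * a i = 0.

Lemma syzygy_submod k (a : 'I_k -> R) : submodule (syzygy a).
Proof.
split; first by rewrite /syzygy big1 // => i _; rewrite mxE mul0r.
move=> c s t; rewrite /syzygy => ss st.
transitivity (c * (\sum_i s 0 i * a i) + \sum_i t 0 i * a i).
  rewrite big_distrr -big_split /=; apply: eq_bigr => i _.
  by rewrite !mxE mulrDl mulrA.
by rewrite ss st mulr0 addr0.
Qed.

(** The relations between generators of a left ideal are the syzygies of these
    generators, so a finite set of syzygies is a finite presentation. *)
Lemma coherent_of_syzygies :
  (forall k (a : 'I_k -> R), fin_gen (syzygy a)) -> left_coherent R.
Proof.
move=> fgR; split.
  exists 1, (fun _ => 1 : R^o) => x; exists (fun _ => x).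
  by rewrite big_ord1 /GRing.scale /= mulr1.
move=> N [k [e eP]].
have [l [lS lgen]] := fgR k (fun i => val (e i) : R).
exists (size l), k, (row_comb (fun i : 'I_(size l) => l`_i)), (row_comb e).
have rcE s : val (row_comb e s) = \sum_i s 0 i * (val (e i) : R).
  by rewrite /row_comb linear_sum; apply: eq_bigr => i _; rewrite linearZ.
split=> [y|x].
  have [c ->] := eP y.
  by exists (\row_i c i); apply: eq_bigr => i _; rewrite mxE.
split=> [gx|[z <-]].
  have sx : syzygy (fun i => val (e i) : R) x by rewrite /syzygy -rcE gx.
  have [y [gy /eqP]] := lgen x sx.
  rewrite subr_eq0 => /eqP ->; have [c ->] := gen_comb gy.
  by exists (\row_i c i); apply: eq_bigr => i _; rewrite mxE.
apply/val_inj; rewrite rcE linear0.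
apply: (submod_sum _ (syzygy_submod (fun i => val (e i) : R))) => i _.
apply: (submodZ _ (syzygy_submod _)).
by apply: lS; apply: mem_nth.
Qed.

Section Cyclic.
Variable a : R.

(** A boolean predicate obtained classically, as the type [submodClosed] requires. *)
Definition left_ideal_of : {pred R^o} := fun x => `[< exists r, x = r * a >].

Lemma left_ideal_of_closed : submod_closed left_ideal_of.
Proof.
split=> [|c u v]; first by apply/asboolP; exists 0; rewrite mul0r.
move=> /asboolP [r ->] /asboolP [s ->]; apply/asboolP; exists (c * r + s).
by rewrite mulrDl -mulrA.
Qed.

HB.instance Definition _ :=
  GRing.isSubmodClosed.Build R R^o left_ideal_of left_ideal_of_closed.

End Cyclic.

(** Schanuel's argument. Let R^m -> R^k -> R a -> 0 be a presentation, let x0 lift a,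
    and let v : R^k -> R satisfy v(x) a = g(x). Then b in the annihilator is
    b (1 - v(x0)) + v(b x0), where b x0 is a relation. *)
Lemma annihilator_fin_gen : left_coherent R ->
  forall a : R, fin_gen (fun b : R^o => b * a = 0).
Proof.
move=> [_ cohR] a; set N : submodClosed R^o := left_ideal_of a.
have aN : (a : R^o) \in N by apply/asboolP; exists 1; rewrite mul1r.
pose a' : submod_type N := Sub a aN.
have : finitely_generated (submod_type N).
  exists 1, (fun _ => a') => x.
  have /asboolP [r xr] := valP x.
  exists (fun _ => r); apply/val_inj.
  by rewrite big_ord1; exact: xr.
move/(cohR N) => [m [k [f [g [gS gf]]]]].
have [x0 gx0] := gS a'.
have rP i : exists r, val (g (delta_mx 0 i)) = r * a.
  by have /asboolP := valP (g (delta_mx 0 i)).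
have [r rE] := choice rP.
pose v : {linear 'rV[R]_k -> R^o} := row_comb (r : 'I_k -> R^o).
have vE x : v x * a = val (g x).
  rewrite (row_combE g) /v /row_comb linear_sum big_distrl; apply: eq_bigr => i _.
  transitivity (x 0 i * (r i * a)); first exact: esym (mulrA _ _ _).
  by rewrite -rE linearZ.
exists ((1 - v x0) :: [seq v (f (delta_mx 0 j)) | j : 'I_m]); split.
  move=> x; rewrite inE => /orP [/eqP ->|/mapP [j _ ->]].
    by rewrite mulrBl vE gx0 mul1r subrr.
  by rewrite vE (_ : g _ = 0) //; apply/gf; exists (delta_mx 0 j).
move=> b ba0; exists b; split; last exact: subrr.
have -> : b = b *: ((1 - v x0) : R^o) + v (b *: x0).
  by rewrite linearZ /= -scalerDr subrK /GRing.scale /= mulr1.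
apply: (submodD (gen_submod _)).
  by apply: (submodZ _ (gen_submod _)); apply: gen_mem; rewrite inE eqxx.
have [z <-] : exists z, f z = b *: x0.
  apply/gf; rewrite linearZ gx0; apply/val_inj; exact: ba0.
rewrite (row_combE f) (linear_sum v).
apply: (submod_sum _ (gen_submod _)) => j _.
rewrite linearZ; apply: (submodZ _ (gen_submod _)).
by apply: gen_mem; rewrite inE; apply/orP; right; apply/mapP; exists j; rewrite ?mem_enum.
Qed.

End CoherenceCriteria.

Section Power.
Variables (R : pzRingType) (F : R^o -> Prop).
Hypothesis F_submod : submodule F.
Hypothesis ideal_fg : forall L : R^o -> Prop, submodule L -> fin_gen_mod L F.

(** The coordinates are pushed into [F] one at a time: the entries at one
    coordinate of the rows whose previous entries lie in [F] form a left ideal,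
    and rows realising generators of this ideal handle that coordinate. *)
Lemma submod_row_fin_gen_mod k (S : 'rV[R]_k -> Prop) :
  submodule S -> fin_gen_mod S (fun s => forall i, F (s 0 i)).
Proof.
move=> sS.
(* Downward induction on the number of entries known to lie in F. *)
pose Sj j (s : 'rV[R]_k) := S s /\ forall i : 'I_k, (i < j)%N -> F (s 0 i).
suff SjP j : (j <= k)%N -> fin_gen_mod (Sj (k - j)%N) (fun s => forall i, F (s 0 i)).
  have [l [lS lg]] := SjP k (leqnn k).
  exists l; split=> [x /lS []//|x Sx]; apply: lg; split=> // i.
  by rewrite subnn.
have Sj_submod i : submodule (Sj i).
  split; first by split=> [|h _]; [exact: submod0 sS|rewrite mxE; exact: submod0 F_submod].
  move=> a s t [Ss Fs] [St Ft]; split; first by case: sS => _; apply.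
  by move=> h hi; rewrite !mxE; case: F_submod => _; apply; [exact: Fs|exact: Ft].
elim: j => [|j IHj] jk.
  exists [::]; split=> // s [_ Fs]; exists 0; split; first exact: submod0 (gen_submod _).
  by move=> i; rewrite subr0; apply: Fs; rewrite subn0.
have i_lt : (k - j.+1 < k)%N by rewrite ltn_subrL /= (leq_ltn_trans _ jk).
pose i := Ordinal i_lt.
apply: (fin_gen_mod_trans (T := fun s : 'rV[R]_k => F (s 0 i)) (Sj_submod _)); last first.
  have [l [lS lg]] := IHj (ltnW jk).
  have SE s : (Sj (k - j.+1)%N s /\ F (s 0 i)) <-> Sj (k - j)%N s.
    rewrite -[(k - j)%N]prednK ?subn_gt0 // -subnS.
    split=> [[[Ss Fs] Fi]|[Ss Fs]]; split=> //.
    - move=> h; rewrite ltnS leq_eqVlt => /orP [/eqP hi|]; last exact: Fs.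
      by rewrite (_ : h = i) //; apply/val_inj.
    - by split=> // h hi; apply: Fs; rewrite ltnS ltnW.
    - exact: Fs.
  exists l; split=> [x /lS /SE [] //|x Sx Fx].
  by apply: lg; apply/SE.
pose L (a : R^o) := exists s, Sj (k - j.+1)%N s /\ a = s 0 i.
have sL : submodule L.
  split; first by exists 0; split; [exact: submod0 (Sj_submod _)|rewrite mxE].
  move=> a _ _ [s [Ss ->]] [t [St ->]]; exists (a *: s + t).
  by split; [case: (Sj_submod (k - j.+1)%N) => _; apply|rewrite !mxE].
have [l [lL lg]] := ideal_fg sL.
have preim a : exists s, a \in l -> Sj (k - j.+1)%N s /\ a = s 0 i.
  by case: (pselect (a \in l)) => [/lL [s ?]|?]; [exists s|exists 0].
have [f fP] := choice preim.
exists (map f l); split=> [_ /mapP [a /fP [Sa _] ->] //|s Ss].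
have [a [ga Fa]] := lg (s 0 i) (ex_intro _ s (conj Ss erefl)).
pose P a := exists t, gen (map f l) t /\ a = t 0 i.
have [t [gt at_]] : P a.
  apply: (gen_in _ _ ga) => [|b lb].
    split; first by exists 0; split; [exact: submod0 (gen_submod _)|rewrite mxE].
    move=> c _ _ [u [gu ->]] [v [gv ->]]; exists (c *: u + v).
    by split; [case: (gen_submod (map f l)) => _; apply|rewrite !mxE].
  by exists (f b); split; [apply: gen_mem; apply: map_f|have [] := fP b lb].
by exists t; split=> //; rewrite !mxE -at_.
Qed.

End Power.

(** * Shift pairs *)

Section PolyShift.
Variable K : fieldType.
Implicit Types (p q : {poly K}) (c d : K).

Definition shiftp c p : {poly K} := p \Po ('X + c%:P).

Lemma shiftp0 p : shiftp 0 p = p.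
Proof. by rewrite /shiftp polyC0 addr0 comp_polyXr. Qed.

Lemma shiftpD c d p : shiftp c (shiftp d p) = shiftp (c + d) p.
Proof.
rewrite /shiftp -comp_polyA comp_polyD comp_polyX comp_polyC.
by rewrite -addrA -polyCD.
Qed.

Lemma horner_shiftp c p x : (shiftp c p).[x] = p.[x + c].
Proof. by rewrite /shiftp horner_comp !hornerE. Qed.

(** In characteristic zero the natural numbers are distinct in [K], and only
    finitely many of them are roots of [p]. *)
Lemma nat_eventually_nonroot p : [pchar K] =i pred0 -> p != 0 ->
  exists m0, forall m, (m0 <= m)%N -> p.[m%:R] != 0.
Proof.
move=> charK; have [n] := ubnP (size p).
elim: n p => // n IHn p; rewrite ltnS => pn p0.
have [[m pm0]|nroot] := pselect (exists m : nat, p.[m%:R] == 0); last first.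
  by exists 0%N => m _; apply/negP => pm; apply: nroot; exists m.
have /factor_theorem [q pE] : root p m%:R by [].
have q0 : q != 0 by apply: contraNneq p0 => q0; rewrite pE q0 mul0r.
have [|m0 qP] := IHn q _ q0.
  apply: leq_trans pn; rewrite pE size_Mmonic ?monicXsubC // size_XsubC addn2 /=.
  by [].
exists (maxn m0 m.+1) => k; rewrite geq_max => /andP [k0 km].
rewrite pE hornerM mulf_neq0 ?qP // !hornerE subr_eq0.
by rewrite -subr_eq0 -natrB ?(ltnW km) // ((pcharf0P K).1 charK) // subn_eq0 -ltnNge.
Qed.

End PolyShift.

(** Think of [h p] as p(theta), theta = x D acting on K[x] and [J] as integration;
    [1 - J * D] is then the projection onto constants. The last two axioms make
    the record self-dual under exchange of [D] and [J] and of the two sides.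
    Applied to constant polynomials, [sp_hD] and [sp_Jh] say that the scalars
    commute with [D] and [J]. *)
Record shift_pair (K : fieldType) (R : pzRingType) (h : {poly K} -> R) (D J : R) :
    Prop := ShiftPair {
  sp_DJ : D * J = 1;
  sp_JD : J * D != 1;
  sp_hD : forall p, h p * D = D * h (shiftp (-1) p);
  sp_Jh : forall p, J * h p = h (shiftp (-1) p) * J;
  sp_eh : forall p, (1 - J * D) * h p = h p.[0]%:P * (1 - J * D);
  sp_he : forall p, h p * (1 - J * D) = h p.[0]%:P * (1 - J * D)
}.

Section ShiftPairTheory.
Variables (K : fieldType) (R : pzRingType) (h : {rmorphism {poly K} -> R}).
Variables (D J : R).
Hypothesis sp : shift_pair h D J.

Local Notation e := (1 - J * D).

Lemma h_Dn n p : h p * D ^+ n = D ^+ n * h (shiftp (- n%:R) p).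
Proof.
elim: n p => [|n IHn] p; first by rewrite oppr0 shiftp0 !expr0 mul1r mulr1.
rewrite exprS mulrA (sp_hD sp) -mulrA IHn mulrA -exprS shiftpD.
by rewrite -opprD -natr1.
Qed.

Lemma Dn_h n p : D ^+ n * h p = h (shiftp n%:R p) * D ^+ n.
Proof. by rewrite h_Dn shiftpD addrC subrr shiftp0. Qed.

Lemma Jn_h n p : J ^+ n * h p = h (shiftp (- n%:R) p) * J ^+ n.
Proof.
elim: n p => [|n IHn] p; first by rewrite oppr0 shiftp0 !expr0 mul1r mulr1.
rewrite exprSr -mulrA (sp_Jh sp) mulrA IHn -mulrA -exprSr shiftpD.
by rewrite -opprD -natr1.
Qed.

Lemma h_Jn n p : h p * J ^+ n = J ^+ n * h (shiftp n%:R p).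
Proof. by rewrite Jn_h shiftpD addrC subrr shiftp0. Qed.

Lemma DnJn n : D ^+ n * J ^+ n = 1.
Proof.
elim: n => [|n IHn]; first by rewrite !expr0 mulr1.
by rewrite exprSr exprS mulrA -[_ * D * J]mulrA (sp_DJ sp) mulr1.
Qed.

Lemma D_idem : D * e = 0.
Proof. by rewrite mulrBr mulr1 mulrA (sp_DJ sp) mul1r subrr. Qed.

Lemma idem_J : e * J = 0.
Proof. by rewrite mulrBl mul1r -mulrA (sp_DJ sp) mulr1 subrr. Qed.

Lemma idem_idem : e * e = e.
Proof. by rewrite {1}mulrBl mul1r -mulrA D_idem mulr0 subr0. Qed.

Lemma eDn_h n p : e * D ^+ n * h p = h (p.[n%:R])%:P * (e * D ^+ n).
Proof.
rewrite -mulrA Dn_h mulrA (sp_eh sp) horner_shiftp add0r.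
by rewrite -mulrA.
Qed.

(** Taylor's formula with remainder: J^n D^n is the remainder, and J^i e D^i
    extracts the term of degree i. *)
Lemma J_resolution n : 1 = J ^+ n * D ^+ n + \sum_(i < n) J ^+ i * (e * D ^+ i).
Proof.
elim: n => [|n IHn]; first by rewrite big_ord0 addr0 !expr0 mulr1.
rewrite big_ord_recr /= addrCA {1}IHn [LHS]addrC; congr (_ + _).
rewrite mulrBl mul1r mulrBr addrC exprSr [D ^+ n.+1]exprS.
by rewrite !mulrA addrNK.
Qed.

Lemma constC_h c p : h c%:P * h p = h p * h c%:P.
Proof. by rewrite -!rmorphM mulrC. Qed.

Lemma monomial_h k p l q :
  J ^+ k * h p * D ^+ l * h q = J ^+ k * h (p * shiftp l%:R q) * D ^+ l.
Proof. by rewrite -mulrA Dn_h mulrA -[J ^+ k * _ * _]mulrA -rmorphM. Qed.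

Lemma const_e c : h c%:P * e = e * h c%:P.
Proof. by rewrite (sp_eh sp) hornerC. Qed.

(** A nonzero scalar is invertible, so e would vanish, against [sp_JD]. *)
Lemma const_e_eq0 c : h c%:P * e = 0 -> c = 0.
Proof.
move=> he; apply: contraTeq isT => c0 /=; have := sp_JD sp.
suff -> : J * D = 1 by rewrite eqxx.
have : h (c^-1)%:P * (h c%:P * e) = 0 by rewrite he mulr0.
rewrite mulrA -rmorphM -polyCM mulVf // rmorph1 mul1r => /eqP.
by rewrite subr_eq0 => /eqP.
Qed.

(** The coordinates on the right module e R, in which e D^j is the monomial X^j.
    For the action on polynomials this is the space of functionals spanned by
    the evaluations at 0 of the derivatives. *)
Definition Psi (c : {poly K}) : R := \sum_(j < size c) h (c`_j)%:P * (e * D ^+ j).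

Lemma PsiE n (c : {poly K}) : (size c <= n)%N -> Psi c = \sum_(j < n) h (c`_j)%:P * (e * D ^+ j).
Proof.
move=> cn; rewrite /Psi (big_ord_widen n (fun j => h (c`_j)%:P * (e * D ^+ j)) cn).
rewrite big_mkcond; apply: eq_bigr => j _; case: ltnP => // cj.
by rewrite nth_default // polyC0 rmorph0 mul0r.
Qed.

Lemma PsiD (c d : {poly K}) : Psi (c + d) = Psi c + Psi d.
Proof.
have cdn : (size (c + d)%R <= maxn (size c) (size d))%N by apply: size_polyD.
rewrite (PsiE cdn) (PsiE (leq_maxl _ (size d))) (PsiE (leq_maxr (size c) _)).
rewrite -big_split; apply: eq_bigr => j _ /=.
by rewrite coefD polyCD rmorphD mulrDl.
Qed.

Lemma PsiZ k c : Psi (k *: c) = h k%:P * Psi c.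
Proof.
rewrite (PsiE (size_scale_leq k c)) big_distrr; apply: eq_bigr => j _ /=.
by rewrite coefZ polyCM rmorphM mulrA.
Qed.

Lemma PsiB c d : Psi (c - d) = Psi c - Psi d.
Proof. by rewrite PsiD -scaleN1r PsiZ polyCN rmorphN rmorph1 mulN1r. Qed.

Lemma Psi0 : Psi 0 = 0.
Proof. by rewrite -(subrr 0) PsiB subrr. Qed.

Lemma Psi_sum (I : Type) (r : seq I) (P : pred I) F :
  Psi (\sum_(i <- r | P i) F i) = \sum_(i <- r | P i) Psi (F i).
Proof. by apply: (big_morph Psi PsiD Psi0). Qed.

Lemma PsiXn j : Psi 'X^j = e * D ^+ j.
Proof.
rewrite /Psi size_polyXn big_ord_recr /= coefXn eqxx polyC1 rmorph1 mul1r.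
rewrite big1 ?add0r // => i _; rewrite coefXn ltn_eqF ?ltn_ord //.
by rewrite polyC0 rmorph0 mul0r.
Qed.

Lemma e_Psi c : e * Psi c = Psi c.
Proof.
rewrite big_distrr; apply: eq_bigr => j _ /=.
by rewrite !mulrA -const_e -[_ * e * e]mulrA idem_idem.
Qed.

Lemma Psi_D c n : Psi c * D ^+ n = Psi (c * 'X^n).
Proof.
have -> : c * 'X^n = \sum_(j < size c) c`_j *: 'X^j * 'X^n.
  by rewrite -big_distrl -poly_def coefK.
rewrite Psi_sum {1}/Psi big_distrl.
apply: eq_bigr => j _ /=. rewrite -scalerAl -exprD PsiZ PsiXn exprD.
by rewrite !mulrA.
Qed.

(** The right action of p(theta) on e R: e D^j is an eigenvector with eigenvalue
    p(j), by [eDn_h]. *)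
Definition hadamard (p c : {poly K}) : {poly K} :=
  \poly_(j < size c) (p.[j%:R] * c`_j).

Lemma coef_hadamard p c j : (hadamard p c)`_j = p.[j%:R] * c`_j.
Proof.
by rewrite coef_poly; case: ltnP => // cj; rewrite nth_default // mulr0.
Qed.

Lemma size_hadamard p c : (size (hadamard p c) <= size c)%N.
Proof. exact: size_poly. Qed.

Lemma Psi_h c p : Psi c * h p = Psi (hadamard p c).
Proof.
rewrite (PsiE (size_hadamard p c)) /Psi big_distrl; apply: eq_bigr => j _ /=.
rewrite coef_hadamard -mulrA eDn_h mulrA polyCM rmorphM constC_h.
by rewrite [h p.[_]%:P * _]constC_h.
Qed.

Lemma Psi_J c : Psi c * J = Psi (drop_poly 1 c).
Proof.
have /PsiE -> : (size (drop_poly 1 c) <= (size c).-1)%N by rewrite size_drop_poly subn1.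
rewrite (PsiE (leqSpred (size c))) big_ord_recl expr0 mulr1.
rewrite mulrDl -[_ * e * J]mulrA idem_J mulr0 add0r big_distrl.
apply: eq_bigr => j _ /=; rewrite coef_drop_poly addn1 /bump /= add1n.
by rewrite exprSr -!mulrA (sp_DJ sp) mulr1.
Qed.

(** The coefficient of X^i is read off by multiplying on the right by J^i, which
    lowers degrees by i, and then by e, which keeps the constant term only. *)
Lemma Psi_eq0 c : Psi c = 0 -> c = 0.
Proof.
move=> Pc0; apply/polyP => i; rewrite coef0; apply: const_e_eq0.
have : Psi (drop_poly i c) * e = 0.
  suff -> : Psi (drop_poly i c) = 0 by rewrite mul0r.
  elim: i => [|i IHi]; first by rewrite drop_poly0l.
  have -> : drop_poly i.+1 c = drop_poly 1 (drop_poly i c).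
    by apply/polyP => j; rewrite !coef_drop_poly -addnA add1n.
  by rewrite -Psi_J IHi mul0r.
suff -> : Psi (drop_poly i c) * e = h (c`_i)%:P * e by [].
set d := drop_poly i c.
have -> : c`_i = d`_0 by rewrite coef_drop_poly.
rewrite (PsiE (leqSpred (size d))) big_ord_recl expr0 mulr1.
rewrite mulrDl -mulrA idem_idem big_distrl /= big1 ?addr0 // => j _.
by rewrite /bump /= add1n exprSr -!mulrA D_idem !mulr0.
Qed.

Lemma Psi_inj : injective Psi.
Proof.
move=> c d cd; apply/eqP; rewrite -subr_eq0; apply/eqP/Psi_eq0.
by rewrite PsiB cd subrr.
Qed.

End ShiftPairTheory.

Section Spanned.
Variables (K : fieldType) (R : pzRingType) (h : {poly K} -> R) (D J : R).

(** Additive spanning by the J^i p(theta) D^j c, phrased as the induction principle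
    that it gives. *)
Definition spanned (C : R -> Prop) : Prop := forall P : R -> Prop,
  (forall a b, P a -> P b -> P (a + b)) ->
  (forall i p j c, C c -> P (J ^+ i * h p * D ^+ j * c)) -> forall a, P a.

End Spanned.

Section Centralizer.
Variables (K : fieldType) (R : pzRingType) (h : {poly K} -> R) (D J : R).

Definition centralizes (c : R) : Prop :=
  [/\ GRing.comm D c, GRing.comm J c & forall p, GRing.comm (h p) c].

End Centralizer.

(** * Leading terms modulo the torsion ideal *)

Section Symbols.
Variables (K : fieldType) (R : pzRingType) (h : {rmorphism {poly K} -> R}).
Variables (D J : R).
Hypothesis charK : [pchar K] =i pred0.
Hypothesis sp : shift_pair h D J.
Hypothesis R_span : spanned h D J (fun c => c = 1).

Local Notation e := (1 - J * D).
Local Notation Psi := (Psi h D J).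

Lemma span_ind (P : R -> Prop) : (forall a b, P a -> P b -> P (a + b)) ->
  (forall i p j, P (J ^+ i * h p * D ^+ j)) -> forall a, P a.
Proof.
by move=> PD Pt; apply: R_span => // i p j c ->; rewrite mulr1.
Qed.

(** The powers of [D] form a left Ore set. *)
Lemma Dn_swap n a : exists m b, D ^+ m * a = b * D ^+ n.
Proof.
elim/span_ind: a => [a b [m [a' aE]] [l [b' bE]]|i p j].
  exists (m + l)%N, (D ^+ l * a' + D ^+ m * b').
  by rewrite mulrDr mulrDl -!mulrA -aE -bE !mulrA -!exprD [(l + m)%N]addnC.
exists (n + i)%N, (h (shiftp n%:R p) * D ^+ j).
rewrite exprD -!mulrA [D ^+ i * _]mulrA (DnJn sp) mul1r mulrA (Dn_h sp).
by rewrite -!mulrA -!exprD addnC.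
Qed.

(** For polynomials in one variable these are the operators of finite rank. *)
Definition D_torsion (a : R^o) : Prop := exists n, D ^+ n * a = 0.

Lemma D_torsion_le n m a : (n <= m)%N -> D ^+ n * a = 0 -> D ^+ m * a = 0.
Proof. by move=> nm Da; rewrite -(subnK nm) exprD -mulrA Da mulr0. Qed.

Lemma D_torsion_submod : submodule D_torsion.
Proof.
split=> [|r a b [n Da] [m Db]]; first by exists 0%N; rewrite mulr0.
have [k [r' rE]] := Dn_swap n r.
exists (k + m)%N; rewrite mulrDr -[RHS]addr0; congr (_ + _).
- rewrite [r *: a]/(r * a) addnC exprD -mulrA (mulrA _ r) rE -mulrA Da.
  by rewrite !mulr0.
- by rewrite (D_torsion_le (leq_addl k m)).
Qed.

Lemma D_torsionMr a b : D_torsion a -> D_torsion (a * b : R^o).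
Proof. by case=> n Da; exists n; rewrite mulrA Da mul0r. Qed.

Lemma Dn_torsion n a : D_torsion (D ^+ n * a) -> D_torsion a.
Proof. by case=> m; rewrite mulrA -exprD => Da; exists (m + n)%N. Qed.

(** If D^n vanished, then so would D^n J^n = 1, hence the whole ring; but
    J D is not 1. *)
Lemma torsion_not1 : ~ D_torsion 1.
Proof.
case=> n; rewrite mulr1 => D0; apply: (negP (sp_JD sp)).
by rewrite -[J]mulr1 -[X in _ * X * _](DnJn sp n) D0 mul0r mulr0 mul0r
  -(DnJn sp n) D0 mul0r.
Qed.

(** Skew polynomials in D with the coefficients on the right of the powers of D,
    so that left multiplication by D does not affect the coefficients. *)
Definition Phi (P : {poly {poly K}}) : R := \sum_(i < size P) D ^+ i * h P`_i.

Lemma PhiE n (P : {poly {poly K}}) :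
  (size P <= n)%N -> Phi P = \sum_(i < n) D ^+ i * h P`_i.
Proof.
move=> Pn; rewrite /Phi (big_ord_widen n (fun i => D ^+ i * h P`_i) Pn).
rewrite big_mkcond; apply: eq_bigr => j _; case: ltnP => // cj.
by rewrite nth_default // rmorph0 mulr0.
Qed.

Lemma PhiD P Q : Phi (P + Q) = Phi P + Phi Q.
Proof.
have PQn : (size (P + Q)%R <= maxn (size P) (size Q))%N by apply: size_polyD.
rewrite (PhiE PQn) (PhiE (leq_maxl _ (size Q))) (PhiE (leq_maxr (size P) _)).
by rewrite -big_split; apply: eq_bigr => j _ /=; rewrite coefD rmorphD mulrDr.
Qed.

Lemma Phi_DX n (P : {poly {poly K}}) : D ^+ n * Phi P = Phi (P * 'X^n).
Proof.
have /PhiE -> : (size (P * 'X^n)%R <= n + size P)%N.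
  by apply: leq_trans (size_polyMleq _ _) _; rewrite size_polyXn addnC addSn.
rewrite big_split_ord /= [X in _ = X + _]big1 ?add0r; last first.
  by move=> i _; rewrite coefMXn ltn_ord rmorph0 mulr0.
rewrite /Phi big_distrr; apply: eq_bigr => i _ /=.
by rewrite coefMXn ltnNge leq_addr /= addKn exprD mulrA.
Qed.

Lemma PhiCX p n : Phi (p%:P * 'X^n) = D ^+ n * h p.
Proof.
rewrite -Phi_DX /Phi; congr (_ * _).
have [->|p0] := eqVneq p 0; first by rewrite size_poly0 big_ord0 rmorph0.
by rewrite size_polyC p0 big_ord1 coefC mul1r.
Qed.

Lemma Phi0 : Phi 0 = 0.
Proof. by rewrite /Phi size_poly0 big_ord0. Qed.

(** The negative powers J^i are cleared by multiplying by a power of D. *)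
Lemma Phi_repr a : exists n P, D ^+ n * a = Phi P.
Proof.
elim/span_ind: a => [a b [n [P aE]] [m [Q bE]]|i p j].
  exists (n + m)%N, (P * 'X^m + Q * 'X^n).
  rewrite PhiD -!Phi_DX -aE -bE mulrDr !mulrA -!exprD; congr (_ + _ * _).
  by rewrite addnC.
exists i, ((shiftp (- j%:R) p)%:P * 'X^j).
by rewrite PhiCX -(h_Dn sp) !mulrA (DnJn sp) mul1r.
Qed.

(** Left multiplication by e kills J and evaluates the polynomials in theta at 0,
    which leaves multiples of the e D^j. *)
Lemma Psi_surj a : exists c, e * a = Psi c.
Proof.
elim/span_ind: a => [a b [c aE] [d bE]|i p j].
  by exists (c + d); rewrite PsiD mulrDr aE bE.
case: i => [|i]; last by exists 0; rewrite Psi0 exprS !mulrA (idem_J sp) !mul0r.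
exists (p.[0] *: 'X^j).
by rewrite expr0 mul1r PsiZ PsiXn mulrA (sp_eh sp) mulrA.
Qed.

Lemma Psi_right a c : exists d, Psi c * a = Psi d.
Proof.
have [d dE] := Psi_surj (Psi c * a).
by exists d; rewrite -dE mulrA (e_Psi sp).
Qed.

(** Among the generators only D raises the degree. *)
Lemma Psi_bounded a : exists r, forall c d,
  Psi c * a = Psi d -> (size d <= size c + r)%N.
Proof.
elim/span_ind: a => [a b [r ar] [s bs]|i p j].
  exists (maxn r s) => c d; rewrite mulrDr.
  have [c1 c1E] := Psi_right a c; have [c2 c2E] := Psi_right b c.
  rewrite c1E c2E -PsiD => /(Psi_inj sp) <-.
  apply: leq_trans (size_polyD _ _) _; rewrite addn_maxr geq_max !leq_max.
  by rewrite (ar _ _ c1E) (bs _ _ c2E) orbT.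
exists j => c d; rewrite !mulrA.
have [c1 c1E c1s] : exists2 c1, Psi c * J ^+ i = Psi c1 & (size c1 <= size c)%N.
  elim: i => [|i [c1 c1E c1s]]; first by exists c; rewrite // expr0 mulr1.
  exists (drop_poly 1 c1); first by rewrite exprSr mulrA c1E (Psi_J sp).
  by rewrite size_drop_poly; apply: leq_trans (leq_subr _ _) c1s.
rewrite c1E (Psi_h sp) Psi_D => /(Psi_inj sp) <-.
apply: leq_trans (size_polyMleq _ _) _; rewrite size_polyXn addnS /= leq_add2r.
exact: leq_trans (size_hadamard _ _) c1s.
Qed.

Lemma Psi_Phi P c : Psi c * Phi P =
  Psi (\sum_(i < size P) hadamard P`_i (c * 'X^i)).
Proof.
rewrite Psi_sum /Phi big_distrr; apply: eq_bigr => i _ /=.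
by rewrite mulrA Psi_D (Psi_h sp).
Qed.

(** The top coefficient of the product is the value of the leading coefficient of
    [P] at the degree of the product, and this value vanishes for finitely many
    degrees only. *)
Lemma Psi_Phi_size P : P != 0 -> exists m0, forall c d,
  Psi c * Phi P = Psi d -> (m0 < size c)%N -> size d = (size c + (size P).-1)%N.
Proof.
move=> P0.
have lP0 : lead_coef P != 0 by rewrite lead_coef_eq0.
have [m0 m0P] := nat_eventually_nonroot charK lP0.
exists m0 => c d; rewrite Psi_Phi => /(Psi_inj sp) <- m0c.
have c0 : c != 0 by rewrite -size_poly_gt0 (leq_ltn_trans _ m0c).
set S := \sum_(_ < _) _; set k := ((size c).-1 + (size P).-1)%N.
have sc : size c = (size c).-1.+1 by rewrite prednK ?size_poly_gt0.
have sP : size P = (size P).-1.+1 by rewrite prednK ?size_poly_gt0.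
have ltP : ((size P).-1 < size P)%N by rewrite -sP.
have kE : (size c + (size P).-1)%N = k.+1 by rewrite {1}sc.
apply/eqP; rewrite eqn_leq kE; apply/andP; split.
  apply: leq_trans (size_sum _ _ _) _; apply/bigmax_leqP => i _.
  apply: leq_trans (size_hadamard _ _) _; rewrite size_mulXn // -kE addnC.
  by rewrite leq_add2l -ltnS -sP.
rewrite ltnNge; apply/negP => /leq_sizeP /(_ k (leqnn k)) /eqP.
have -> : S`_k = (lead_coef P).[k%:R] * lead_coef c; last first.
  rewrite mulf_eq0 lead_coef_eq0 (negPf c0) orbF; apply/negP/m0P.
  by rewrite -ltnS -kE (leq_trans m0c) ?leq_addr.
rewrite /S coef_sum (bigD1 (Ordinal ltP)) //=.
rewrite coef_hadamard coefMXn ltnNge leq_addl addnK big1 ?addr0 // => i iP.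
have iP' : (i < (size P).-1)%N.
  by rewrite ltn_neqAle iP -ltnS -sP ltn_ord.
rewrite coef_hadamard coefMXn ltnNge (leq_trans (ltnW iP')) ?leq_addl //=.
rewrite [c`__]nth_default ?mulr0 // /k {1}sc.
by rewrite -addnBA ?(ltnW iP') // -addn1 leq_add2l subn_gt0.
Qed.

(** A high degree part of [c] is a multiple of D^n, on which [a] acts as D^n a, a
    nonzero skew polynomial. The remaining part has degree below n and contributes
    a bounded degree. The constant [n] on the left avoids a negative shift. *)
Lemma Psi_size a : ~ D_torsion a -> exists m0 n d, forall c c',
  Psi c * a = Psi c' -> (m0 < size c)%N -> (size c' + n)%N = (size c + d)%N.
Proof.
move=> Fa; have [n [P aE]] := Phi_repr a.
have P0 : P != 0.
  by apply/eqP => P0; apply: Fa; exists n; rewrite aE P0 Phi0.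
have [m0 m0P] := Psi_Phi_size P0; have [r rP] := Psi_bounded a.
(* The part of c above degree n must have size over m0, and its product with
Phi P must dominate the rest, of size at most n + r. *)
exists (n + m0 + (n + r))%N, n, (size P).-1 => c c' caE m0c.
have [d dE] := Psi_right (Phi P) (drop_poly n c).
have [l lE] := Psi_right a (take_poly n c).
have nc : (n <= size c)%N.
  by apply: leq_trans (ltnW m0c); rewrite -addnA leq_addr.
have sd : size d = (size c - n + (size P).-1)%N.
  rewrite -size_drop_poly; apply: m0P dE _.
  by rewrite size_drop_poly ltn_subRL (leq_ltn_trans _ m0c) // leq_addr.
have -> : c' = l + d.
  apply: (Psi_inj sp); rewrite -caE PsiD -dE -lE -aE mulrA Psi_D -mulrDl -PsiD.
  by rewrite poly_take_drop.
rewrite addrC size_polyDl sd; first by rewrite addnAC subnK.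
apply: leq_ltn_trans (rP _ _ lE) _.
apply: leq_ltn_trans (_ : n + r < _)%N.
  by rewrite leq_add2r size_take_poly.
by lia.
Qed.

(** Both factors send large degrees to large degrees, so the product kills no e D^j
    with j large, whereas a torsion element kills e D^j for all large j. *)
Lemma non_torsionM a b : ~ D_torsion a -> ~ D_torsion b -> ~ D_torsion (a * b).
Proof.
move=> Fa Fb [k kab].
have [m [n [d aP]]] := Psi_size Fa; have [m' [n' [d' bP]]] := Psi_size Fb.
pose j := (k + m + n + m' + n')%N.
have [c cE] := Psi_right a 'X^j.
have c0 : Psi c * b = Psi 0.
  by rewrite -cE PsiXn -mulrA -mulrA (D_torsion_le _ kab) ?mulr0 ?Psi0 // /j; lia.
have sc : (size c + n = j.+1 + d)%N.
  rewrite -(size_polyXn K j); apply: aP cE _.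
  by rewrite size_polyXn /j; lia.
have : (m' + n' < size c)%N.
  by move: sc; rewrite /j; lia.
move=> sc'; have := bP _ _ c0 (leq_ltn_trans (leq_addr _ _) sc').
by rewrite size_poly0; lia.
Qed.

(** In every large degree there is an element e D^j u, by [Psi_size], which cancels
    the leading term. *)
Lemma Psi_reduce u : ~ D_torsion u -> exists n, forall c, exists r c',
  [/\ e * r = r, Psi c - r * u = Psi c' & (size c' <= n)%N].
Proof.
move=> Fu; have [m [n [d uP]]] := Psi_size Fu.
exists (m + n.+1 + d)%N => c.
have [k] := ubnP (size c); elim: k c => // k IHk c; rewrite ltnS => ck.
have [cs|cs] := leqP (size c) (m + n.+1 + d).
  by exists 0, c; rewrite mulr0 mul0r subr0.
have c_gt0 : (0 < size c)%N by apply: leq_ltn_trans cs.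
(* By the choice of j, the element e D^j u has the same size as c. *)
pose j := (size c + n - d).-1.
have jE : (j.+1 + d = size c + n)%N by rewrite /j; lia.
have [c1 c1E] := Psi_right u 'X^j.
have sc1 : size c1 = size c.
  apply/eqP; rewrite -(eqn_add2r n) -jE -(size_polyXn K j).
  apply/eqP; apply: uP c1E _; rewrite size_polyXn; lia.
have c10 : c1 != 0 by rewrite -size_poly_gt0 sc1.
pose z := lead_coef c / lead_coef c1.
have [|r [c' [er rE c's]]] := IHk (c - z *: c1).
  apply: leq_trans ck; rewrite -(prednK c_gt0) ltnS; apply/leq_sizeP => i.
  rewrite leq_eqVlt => /orP [/eqP <-|ci].
    rewrite coefB coefZ -{2}sc1 -/(lead_coef c1) -/(lead_coef c) /z divfK ?subrr //.
    by rewrite lead_coef_eq0.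
  have ci' : (size c <= i)%N by rewrite -(prednK c_gt0).
  by rewrite coefB coefZ !nth_default ?mulr0 ?subrr // sc1.
exists (h z%:P * (e * D ^+ j) + r), c'; split=> //.
  by rewrite mulrDr er -(PsiXn h) -PsiZ (e_Psi sp).
by rewrite -rE mulrDl opprD addrA PsiB PsiZ -c1E PsiXn !mulrA.
Qed.

End Symbols.

(** * Left ideals and common multiples modulo torsion *)

Lemma poly_ideal_principal (K : fieldType) (I : {poly K} -> Prop) :
  I 0 -> (forall p q, I p -> I q -> I (p + q)) -> (forall q p, I p -> I (q * p)) ->
  exists g, I g /\ forall p, I p -> exists q, p = q * g.
Proof.
move=> I0 ID IM.
have [[p0 [Ip0 p00]]|Inil] := pselect (exists p, I p /\ p != 0); last first.
  exists 0; split=> // p Ip; exists 0; rewrite mul0r.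
  by apply/eqP/negP => p0; apply: Inil; exists p; split=> //; apply/negP.
have exn : exists n, `[< exists p, [/\ I p, p != 0 & size p = n] >].
  by exists (size p0); apply/asboolP; exists p0.
case: (ex_minnP exn) => n /asboolP [g [Ig g0 gn]] nmin.
exists g; split=> // p Ip; exists (p %/ g); rewrite {1}(divp_eq p g).
suff -> : p %% g = 0 by rewrite addr0.
apply/eqP/negP => /negP m0.
have Im : I (p %% g).
  have -> : p %% g = p + (- (p %/ g)) * g by rewrite {2}(divp_eq p g) mulNr addrAC subrr add0r.
  by apply: ID => //; apply: IM.
have /nmin : `[< exists q, [/\ I q, q != 0 & size q = size (p %% g)] >].
  by apply/asboolP; exists (p %% g).
by rewrite leqNgt -gn ltn_modp g0.
Qed.

Section Coherence.
Variables (K : fieldType) (R : pzRingType) (h : {rmorphism {poly K} -> R}).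
Variables (D J : R).
Hypothesis charK : [pchar K] =i pred0.
Hypothesis sp : shift_pair h D J.
Hypothesis R_span : spanned h D J (fun c => c = 1).

Local Notation e := (1 - J * D).
Local Notation Psi := (Psi h D J).
Local Notation Phi := (Phi h D).
Local Notation D_torsion := (D_torsion D).

Lemma Phi_sub P Q : Phi (P - Q) = Phi P - Phi Q.
Proof.
by apply/eqP; rewrite eq_sym subr_eq -PhiD subrK.
Qed.

(** Left multiplication by p(theta) multiplies the coefficient at i by p(theta - i),
    which the shift turns into [q] at i = [d]. *)
Lemma h_Phi q (P : {poly {poly K}}) d : exists P',
  [/\ h (shiftp d%:R q) * Phi P = Phi P', (size P' <= size P)%N & P'`_d = q * P`_d].
Proof.
pose P' := \poly_(i < size P) (shiftp (- i%:R) (shiftp d%:R q) * P`_i).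
have PE i : P'`_i = shiftp (- i%:R) (shiftp d%:R q) * P`_i.
  by rewrite coef_poly; case: ltnP => // Pi; rewrite nth_default // mulr0.
exists P'; split; last by rewrite PE shiftpD addNr shiftp0.
- rewrite (PhiE _ _ (size_poly _ _ : size P' <= size P)%N) /Phi big_distrr.
  by apply: eq_bigr => i _ /=; rewrite PE mulrA (h_Dn sp) -mulrA rmorphM.
- exact: size_poly.
Qed.

Lemma Phi_cancel q (P Q : {poly {poly K}}) d : (size P <= d.+1)%N -> (size Q <= d.+1)%N ->
  P`_d = q * Q`_d ->
  exists r P', Phi P = r * Phi Q + Phi P' /\ (size P' <= d)%N.
Proof.
move=> Pd Qd PQ; have [Q' [QE Qs Q'd]] := h_Phi q Q d.
exists (h (shiftp d%:R q)), (P - Q'); rewrite QE Phi_sub addrC subrK; split=> //.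
apply/leq_sizeP => i; rewrite leq_eqVlt => /orP [/eqP <-|di].
  by rewrite coefB PQ Q'd subrr.
by rewrite coefB !nth_default ?subrr // (leq_trans _ di) // (leq_trans Qs).
Qed.

(** Hilbert's basis theorem for skew polynomials. The coefficients at [d] of the
    elements of degree at most [d] in [L] form an ideal of K[X], which grows with [d]
    since left multiplication by D preserves coefficients. A generator of the union
    cancels all the leading terms of degree at least [d0]; generators of the
    ideals for smaller [d] deal with the finitely many degrees below. *)
Lemma left_ideal_fin_gen_mod (L : R^o -> Prop) : submodule L -> fin_gen_mod L D_torsion.
Proof.
move=> sL.
pose top d p := exists P : {poly {poly K}}, [/\ L (Phi P), (size P <= d.+1)%N & P`_d = p].
have top0 d : top d 0.
  by exists 0; rewrite Phi0 size_poly0 coef0; split=> //; exact: submod0 sL.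
have topD d p q : top d p -> top d q -> top d (p + q).
  move=> [P [LP Pd <-]] [Q [LQ Qd <-]]; exists (P + Q); rewrite PhiD coefD; split=> //.
    exact: submodD sL LP LQ.
  by rewrite (leq_trans (size_polyD _ _)) // geq_max Pd.
have topM d q p : top d p -> top d (q * p).
  move=> [P [LP Pd <-]]; have [P' [PE P's P'd]] := h_Phi q P d.
  exists P'; rewrite -PE (leq_trans P's) //; split=> //.
  exact: (submodZ _ sL LP).
have topS d m p : top d p -> top (d + m)%N p.
  move=> [P [LP Pd <-]]; exists (P * 'X^m); rewrite -Phi_DX; split.
  - exact: (submodZ _ sL LP).
  - have [->|P0] := eqVneq P 0; first by rewrite mul0r size_poly0.
    by rewrite size_mulXn // addnC -addSn leq_add2r.
  - by rewrite coefMXn ltnNge leq_addl addnK.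
(* The elements of degree below d, by induction on d. *)
have low d : exists l : seq R^o, (forall x, x \in l -> L x) /\
    forall P : {poly {poly K}}, L (Phi P) -> (size P <= d)%N -> gen l (Phi P).
  elim: d => [|d [l [lL lg]]].
    exists [::]; split=> // P _; rewrite size_poly_leq0 => /eqP ->.
    by rewrite Phi0; exact: submod0 (gen_submod _).
  have [g [[Q [LQ Qd gE]] gP]] := poly_ideal_principal (top0 d) (topD d) (topM d).
  exists ((Phi Q : R^o) :: l); split=> [x|P LP Pd].
    by rewrite inE => /orP [/eqP ->|/lL].
  have [q qE] := gP P`_d (ex_intro _ P (And3 LP Pd erefl)).
  rewrite -gE in qE.
  have [r [P' [PE P'd]]] := Phi_cancel Pd Qd qE; rewrite PE.
  have gQ : gen ((Phi Q : R^o) :: l) (r *: (Phi Q : R^o)).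
    by apply: (submodZ _ (gen_submod _)); apply: gen_mem; rewrite inE eqxx.
  apply: (submodD (gen_submod _) gQ).
  apply: gen_trans (lg P' _ P'd) => [y ly|]; first by apply: gen_mem; rewrite inE ly orbT.
  have -> : Phi P' = Phi P - r *: (Phi Q : R^o) by rewrite PE addrC addKr.
  by apply: (submodB sL LP); exact: submodZ _ sL LQ.
have [g [[d0 [Q [LQ Qd gE]]] gP]] : exists g, (exists d, top d g) /\
    forall p, (exists d, top d p) -> exists q, p = q * g.
  apply: poly_ideal_principal => [|p q [d pd] [d' qd]|q p [d pd]].
  - by exists 0%N.
  - by exists (d + d')%N; apply: topD; [exact: topS|rewrite addnC; exact: topS].
  - by exists d; apply: topM.
have [l [lL lg]] := low d0.
pose l' := (Phi Q : R^o) :: l.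
(* Multiplying by D^(d - d0) moves the leading term of Q up to degree d. *)
have high P : L (Phi P) -> gen l' (Phi P).
  have [n] := ubnP (size P); elim: n P => // n IHn P; rewrite ltnS => Pn LP.
  have [Pd|Pd] := leqP (size P) d0.
    by apply: gen_trans (lg P LP Pd) => y ly; apply: gen_mem; rewrite inE ly orbT.
  pose d := (size P).-1; have dE : size P = d.+1 by rewrite prednK // (leq_ltn_trans _ Pd).
  have [q qE] : exists q, P`_d = q * g.
    by apply: gP; exists d, P; rewrite dE.
  have QX : (size (Q * 'X^(d - d0))%R <= d.+1)%N.
    have [->|Q0] := eqVneq Q 0; first by rewrite mul0r size_poly0.
    by rewrite size_mulXn //; lia.
  have PQX : P`_d = q * (Q * 'X^(d - d0))`_d.
    rewrite coefMXn ltnNge leq_subr subKn ?gE //; lia.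
  have Pd' : (size P <= d.+1)%N by rewrite dE.
  have [r [P' [PE P'd]]] := Phi_cancel Pd' QX PQX.
  have gQ : gen l' ((r * D ^+ (d - d0)) *: (Phi Q : R^o)).
    by apply: (submodZ _ (gen_submod _)); apply: gen_mem; rewrite inE eqxx.
  have PE' : Phi P = (r * D ^+ (d - d0)) *: (Phi Q : R^o) + Phi P'.
    by rewrite PE -Phi_DX mulrA.
  rewrite PE'; apply: (submodD (gen_submod _) gQ); apply: IHn.
    by rewrite (leq_ltn_trans P'd) -?dE.
  have -> : Phi P' = Phi P - (r * D ^+ (d - d0)) *: (Phi Q : R^o) by rewrite PE' addrC addKr.
  by apply: (submodB sL LP); exact: submodZ _ sL LQ.
exists l'; split=> [x|s Ls].
  by rewrite inE => /orP [/eqP ->|/lL].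
have [n [P sE]] := Phi_repr sp R_span s.
exists (J ^+ n *: (D ^+ n *: s)); split.
  apply: (submodZ _ (gen_submod _)); rewrite [_ *: s]sE; apply: high.
  by rewrite -sE; exact: (submodZ _ sL).
exists n; have -> : J ^+ n *: (D ^+ n *: s) = J ^+ n * (D ^+ n * s) by [].
by rewrite mulrBr (mulrA (D ^+ n)) (DnJn sp) mul1r subrr.
Qed.

(** The left ideal spanned by the b a^i is finitely generated modulo torsion, which
    gives a relation between finitely many of the b a^i. In a relation of minimal
    length the coefficient of b is not torsion, since otherwise a could be
    cancelled on the right by [non_torsionM]. *)
Lemma Ore_mod_torsion a b : ~ D_torsion a ->
  exists r y, ~ D_torsion r /\ D_torsion (r * b + y * a).
Proof.
move=> Fa.
pose L n (x : R^o) := exists c : nat -> R, x = \sum_(i < n) c i * b * a ^+ i.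
have L_submod n : submodule (L n).
  split; first by exists (fun _ => 0); rewrite big1 // => i _; rewrite !mul0r.
  move=> r _ _ [c ->] [d ->]; exists (fun i => r * c i + d i).
  rewrite scaler_sumr -big_split; apply: eq_bigr => i _.
  by rewrite !mulrDl -!mulrA.
have L_le n m x : (n <= m)%N -> L n x -> L m x.
  move=> nm [c ->]; exists (fun i => if (i < n)%N then c i else 0).
  rewrite (big_ord_widen m (fun i => c i * b * a ^+ i) nm) big_mkcond.
  by apply: eq_bigr => i _; case: ifP => // _; rewrite !mul0r.
have sL : submodule (fun x => exists n, L n x).
  split; first by exists 0%N; exact: submod0 (L_submod _).
  move=> r x y [n Lx] [m Ly]; exists (n + m)%N.
  case: (L_submod (n + m)%N) => _; apply.
    by apply: L_le Lx; rewrite leq_addr.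
  by apply: L_le Ly; rewrite leq_addl.
have [l [lL lg]] := left_ideal_fin_gen_mod sL.
have [N lN] : exists N, forall x, x \in l -> L N x.
  elim: l lL {lg} => [|x l IHl] lL; first by exists 0%N.
  have [N NP] := IHl (fun y ly => lL y (mem_behead (s := x :: l) ly)).
  have [n Lx] := lL x (mem_head _ _).
  exists (n + N)%N => y; rewrite inE => /orP [/eqP ->|/NP].
    by apply: L_le Lx; rewrite leq_addr.
  by apply: L_le; rewrite leq_addl.
have [y [gy Fy]] : exists y, gen l y /\ D_torsion (b * a ^+ N - y).
  apply: lg; exists N.+1, (fun i => (i == N)%:R).
  rewrite big_ord_recr /= eqxx mul1r big1 ?add0r // => i _.
  by rewrite ltn_eqF ?ltn_ord // !mul0r.
have [c yE] := gen_in (L_submod N) lN gy.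
pose relation n := exists c : nat -> R,
  (exists2 i : nat, (i < n)%N & ~ D_torsion (c i)) /\
  D_torsion (\sum_(i < n) c i * b * a ^+ i).
have : relation N.+1.
  exists (fun i => if (i < N)%N then - c i else 1); split.
    by exists N => //; rewrite ltnn; exact: torsion_not1 sp.
  rewrite big_ord_recr /= ltnn mul1r addrC.
  have -> : \sum_(i < N) (if (i < N)%N then - c i else 1) * b * a ^+ i = - y.
    by rewrite yE -sumrN; apply: eq_bigr => i _; rewrite ltn_ord !mulNr.
  exact: Fy.
elim: N.+1 => [[? [[]]] //|n IHn] [d [[i i_n Fi] Fd]].
have [F0|F0] := pselect (D_torsion (d 0%N)); last first.
  exists (d 0%N), (\sum_(i < n) d i.+1 * b * a ^+ i); split=> //.
  move: Fd; rewrite big_ord_recl /= expr0 mulr1 big_distrl /=.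
  suff -> : \sum_(i < n) d (bump 0 i) * b * a ^+ bump 0 i =
    \sum_(i < n) d i.+1 * b * a ^+ i * a by [].
  by apply: eq_bigr => j _; rewrite /bump /= add1n exprSr !mulrA.
apply: IHn; exists (fun i => d i.+1); split.
  by case: i i_n Fi => // i i_n Fi; exists i.
have [//|nF] := pselect (D_torsion (\sum_(i < n) d i.+1 * b * a ^+ i)).
case: (non_torsionM charK sp R_span nF Fa).
have -> : (\sum_(i < n) d i.+1 * b * a ^+ i) * a =
    \sum_(i < n.+1) d i * b * a ^+ i - d 0%N * b.
  rewrite big_ord_recl /= expr0 mulr1 addrC addrA addNr add0r big_distrl.
  by apply: eq_bigr => j _; rewrite /bump /= add1n exprSr !mulrA.
apply: (submodB (D_torsion_submod sp R_span) Fd).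
exact: D_torsionMr.
Qed.

End Coherence.

(** * Finiteness of syzygies *)

(** A subspace contained in [P] of maximal dimension exhausts [P]. *)
Lemma subspace_fin_gen (K : fieldType) (V : vectType K) (P : V -> Prop) :
  submodule P -> fin_gen P.
Proof.
move=> sP.
pose Q (n : nat) := `[< exists U : {vspace V}, (forall v, v \in U -> P v) /\ \dim U = n >].
have exQ : exists n, Q n.
  exists 0%N; apply/asboolP; exists 0%VS; rewrite dimv0; split=> // v.
  by rewrite memv0 => /eqP ->; exact: submod0 sP.
have ubQ n : Q n -> (n <= \dim {:V})%N.
  by move=> /asboolP [U [_ <-]]; apply: dimvS; apply: subvf.
case: (ex_maxnP exQ ubQ) => n /asboolP [U [UP Un]] nmax.
exists (vbasis U); split=> [x /vbasis_mem /UP //|x Px].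
exists x; split; last exact: subrr.
suff xU : x \in U.
  rewrite (coord_vbasis xU); apply: (submod_sum _ (gen_submod _)) => i _.
  by apply: (submodZ _ (gen_submod _)); apply: gen_mem; apply: mem_nth; rewrite size_tuple.
have /nmax : Q (\dim (U + <[x]>)%VS).
  apply/asboolP; exists (U + <[x]>)%VS; split=> // v /memv_addP [u uU [w /vlineP [k ->] ->]].
  by apply: (submodD sP); [exact: UP|exact: (submodZ _ sP)].
rewrite -Un => dimU.
have /eqP -> : U == (U + <[x]>)%VS by rewrite eqEdim addvSl.
by apply: subvP (addvSr _ _) _ (memv_line x).
Qed.

Section Syzygies.
Variables (K : fieldType) (R : pzRingType) (h : {rmorphism {poly K} -> R}).
Variables (D J : R).
Hypothesis charK : [pchar K] =i pred0.
Hypothesis sp : shift_pair h D J.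
Hypothesis R_span : spanned h D J (fun c => c = 1).

Local Notation e := (1 - J * D).
Local Notation Psi := (Psi h D J).
Local Notation D_torsion := (D_torsion D).

(** If D^n s = 0, then [J_resolution] expresses [s] through the rows e D^i s, which
    are fixed by e. *)
Lemma torsion_row_gen k (S : 'rV[R]_k -> Prop) (l : seq 'rV[R]_k) :
  submodule S -> (forall w, S w -> e *: w = w -> gen l w) ->
  forall s, S s -> (forall i, D_torsion (s 0 i)) -> gen l s.
Proof.
move=> sS lP s Ss Fs; have [f fP] := choice Fs.
pose n := (\max_i f i)%N.
have Ds : D ^+ n *: s = 0.
  apply/rowP => i; rewrite !mxE; apply: D_torsion_le (fP i).
  exact: leq_bigmax.
rewrite -[s]scale1r (J_resolution D J n) scalerDl -scalerA Ds scaler0 add0r.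
rewrite scaler_suml; apply: (submod_sum _ (gen_submod _)) => i _.
rewrite -scalerA; apply: (submodZ _ (gen_submod _)); apply: lP.
  exact: submodZ _ sS Ss.
by rewrite scalerA mulrA (idem_idem sp).
Qed.

Definition bounded_row k n (w : 'rV[R]_k) : Prop :=
  forall i, exists c, w 0 i = Psi c /\ (size c <= n)%N.

(** Such rows are parametrised by the k by n matrices over [K]. *)
Lemma bounded_row_fin_gen k n (S : 'rV[R]_k -> Prop) : submodule S ->
  exists l, (forall x, x \in l -> S x) /\ forall w, S w -> bounded_row n w -> gen l w.
Proof.
move=> sS.
(* The row of the matrix at i is the sequence of coordinates of the entry at i. *)
pose T (M : 'M[K]_(k, n)) : 'rV[R]_k := \row_i Psi (rVpoly (row i M)).
have TE a M N : T (a *: M + N) = h a%:P *: T M + T N.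
  apply/rowP => i; rewrite !mxE !linearD /= linearZ /= linearZ /= PsiD PsiZ.
  by [].
have T0 : T 0 = 0.
  by apply/rowP => i; rewrite !mxE !linear0 Psi0.
have sST : submodule (fun M => S (T M)).
  split; first by rewrite T0; exact: submod0 sS.
  by move=> a M N SM SN; rewrite TE; case: sS => _; apply.
have [l [lS lg]] := subspace_fin_gen sST.
exists [seq T M | M <- l]; split=> [_ /mapP [M lM ->]|w Sw wb].
  exact: lS.
have [c cP] := choice wb.
have wE : T (\matrix_(i, j) (c i)`_j) = w.
  apply/rowP => i; have [-> ci] := cP i; rewrite mxE; congr (Psi _).
  apply/polyP => j; rewrite coef_rVpoly; case: insubP => [u jn uj|].
    by rewrite !mxE uj.
  by rewrite -leqNgt => nj; rewrite nth_default // (leq_trans ci).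
rewrite -wE in Sw *; have [M [gM /eqP]] := lg _ Sw.
rewrite subr_eq0 => /eqP ->.
pose P N := gen [seq T M | M <- l] (T N).
apply: (gen_in (S := P) _ _ gM) => [|N lN]; last by apply: gen_mem; apply: map_f.
split; first by rewrite /P T0; exact: submod0 (gen_submod _).
by move=> a N N' gN gN'; rewrite /P TE; case: (gen_submod [seq T M | M <- l]) => _; apply.
Qed.

Lemma Psi_fixed x : e * x = x -> exists c, x = Psi c.
Proof. by move=> <-; exact: Psi_surj. Qed.

(** As [u i] vanishes at the coordinates in [Q] other than [i], the coordinates can
    be reduced independently of each other. *)
Lemma reduce_row k (Q : pred 'I_k) (u : 'I_k -> 'rV[R]_k) :
  (forall i, Q i -> ~ D_torsion (u i 0 i)) ->
  (forall i j, Q i -> Q j -> j != i -> u i 0 j = 0) ->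
  exists n, forall w, e *: w = w -> exists t,
    [/\ gen [seq u i | i <- enum Q] t, e *: (w - t) = w - t &
        forall i, Q i -> exists c, (w - t) 0 i = Psi c /\ (size c <= n)%N].
Proof.
move=> Fu u0.
have red i : exists n, Q i -> forall c, exists r c',
    [/\ e * r = r, Psi c - r * u i 0 i = Psi c' & (size c' <= n)%N].
  case: (boolP (Q i)) => Qi; last by exists 0%N.
  by have [n nP] := Psi_reduce charK sp R_span (Fu i Qi); exists n.
have [f fP] := choice red.
exists (\max_i f i)%N => w ew.
have wP i : exists r, Q i -> e * r = r /\
    exists c', w 0 i - r * u i 0 i = Psi c' /\ (size c' <= f i)%N.
  case: (boolP (Q i)) => Qi; last by exists 0.
  have [c wc] : exists c, w 0 i = Psi c.
    by apply: Psi_fixed; rewrite -{2}ew mxE.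
  have [r [c' [er rE c's]]] := fP i Qi c.
  by exists r => _; split=> //; exists c'; rewrite wc.
have [r rP] := choice wP.
exists (\sum_(i | Q i) r i *: u i); split.
- apply: (submod_sum _ (gen_submod _)) => i Qi.
  apply: (submodZ _ (gen_submod _)); apply: gen_mem.
  by apply: map_f; rewrite mem_enum.
- rewrite scalerBr ew scaler_sumr; congr (_ - _); apply: eq_bigr => i Qi.
  by have [er _] := rP i Qi; rewrite scalerA er.
- move=> i Qi; have [_ [c' [wE c's]]] := rP i Qi; exists c'; split.
    rewrite -wE !mxE summxE (bigD1 i) //= mxE big1 ?addr0 // => j /andP [Qj ji].
    by rewrite mxE u0 ?mulr0 // eq_sym.
  by apply: leq_trans c's _; exact: leq_bigmax.
Qed.

Lemma syzygy_fin_gen k (a : 'I_k -> R) : fin_gen (syzygy a).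
Proof.
have sS := syzygy_submod a; set S := syzygy a in sS *.
have sF : submodule D_torsion by exact: D_torsion_submod sp R_span.
have ideal_fg := left_ideal_fin_gen_mod sp R_span.
apply: (fin_gen_mod_trans sS (submod_row_fin_gen_mod sF ideal_fg sS)).
suff [n [l [lS lP]]] : exists n l, (forall x, x \in l -> S x) /\
    forall w, S w -> e *: w = w -> exists2 t, gen l t & bounded_row n (w - t).
  have [l' [l'S l'P]] := bounded_row_fin_gen n sS.
  exists (l ++ l'); split=> [x|s Ss Fs].
    by rewrite mem_cat => /orP [/lS|/l'S].
  exists s; split; last exact: subrr.
  apply: (torsion_row_gen sS _ Ss Fs) => w Sw ew.
  have [t gt bt] := lP w Sw ew; rewrite -(subrK t w).
  apply: (submodD (gen_submod _)).
    have St : S (w - t) by apply: (submodB sS Sw); exact: gen_in gt.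
    apply: gen_trans (l'P _ St bt) => y ly.
    by apply: gen_mem; rewrite mem_cat ly orbT.
  by apply: gen_trans gt => y ly; apply: gen_mem; rewrite mem_cat ly.
have [[i0 Fi0]|Fa] := pselect (exists i, ~ D_torsion (a i)); last first.
  have Fai i : D_torsion (a i).
    by have [//|F] := pselect (D_torsion (a i)); case: Fa; exists i.
  have [f fP] := choice Fai.
  (* D^(f i) kills a_i, so this row is a syzygy. *)
  pose u i : 'rV[R]_k := D ^+ f i *: delta_mx 0 i.
  have uE i j : u i 0 j = if j == i then D ^+ f i else 0.
    by rewrite !mxE eqxx /=; case: (j == i); rewrite ?mulr1 ?mulr0.
  have [n nP] : exists n, forall w, e *: w = w -> exists t,
    [/\ gen [seq u i | i <- enum predT] t, e *: (w - t) = w - t &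
        forall i, predT i -> exists c, (w - t) 0 i = Psi c /\ (size c <= n)%N].
    apply: reduce_row => [i _|i j _ _ /negPf ji]; last by rewrite uE ji.
    rewrite uE eqxx -[D ^+ _]mulr1 => /Dn_torsion; exact: torsion_not1 sp.
  exists n, [seq u i | i <- enum predT]; split=> [_ /mapP [i _ ->]|w Sw ew].
    rewrite /S /syzygy (bigD1 i) //= uE eqxx fP add0r big1 // => j /negPf ji.
    by rewrite uE ji mul0r.
  by have [t [gt _ bt]] := nP w ew; exists t => // i; apply: bt.
(* Common multiples of a_i and a_i0 agree up to torsion only; the factor D^m
turns the relation into a syzygy. *)
have ore i : exists u : 'rV[R]_k, i != i0 -> [/\ S u, ~ D_torsion (u 0 i) &
    forall j, j != i0 -> j != i -> u 0 j = 0].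
  have [->|ii0] := eqVneq i i0; first by exists 0.
  have [r [y [Fr [m rya]]]] := Ore_mod_torsion charK sp R_span (a i) Fi0.
  exists (\row_j if j == i then D ^+ m * r else if j == i0 then D ^+ m * y else 0).
  move=> _; split.
  - rewrite /S /syzygy (bigD1 i) //= (bigD1 i0) 1?eq_sym //= big1 => [|j /andP [/negPf ji /negPf ji0]].
      rewrite !mxE eqxx [i0 == i]eq_sym (negPf ii0) eqxx addr0 -!mulrA -mulrDr.
      exact: rya.
    by rewrite mxE ji ji0 mul0r.
  - by rewrite mxE eqxx => /Dn_torsion.
  - by move=> j /negPf ji0 /negPf ji; rewrite mxE ji ji0.
have [u uP] := choice ore.
have [n nP] : exists n, forall w, e *: w = w -> exists t,
  [/\ gen [seq u i | i <- enum (predC1 i0)] t, e *: (w - t) = w - t &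
      forall i, predC1 i0 i -> exists c, (w - t) 0 i = Psi c /\ (size c <= n)%N].
  apply: reduce_row => [i /uP [] //|i j /uP [_ _ ui] ji0 ji]; exact: ui.
have uS x : x \in [seq u i | i <- enum (predC1 i0)] -> S x.
  by move=> /mapP [i ii0 ->]; have [] := uP i; rewrite mem_enum in ii0.
have [f fP] := choice (fun i => Psi_bounded sp R_span (a i)).
have [m0 [n0 [d dP]]] := Psi_size charK sp R_span Fi0.
pose r := (\max_i f i)%N.
(* The coordinate at i0, multiplied by a_i0, has size at most n + r; if its own
size exceeds m0, the latter is at most n + r + n0 by the choice of n0. *)
exists (m0 + n + r + n0)%N, [seq u i | i <- enum (predC1 i0)]; split=> // w Sw ew.
have [t [gt ewt bt]] := nP w ew; exists t => // i.
have [->|ii0] := eqVneq i i0; last first.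
  by have [c [wc cn]] := bt i ii0; exists c; split=> //; lia.
have [c wc] : exists c, (w - t) 0 i0 = Psi c.
  by apply: Psi_fixed; rewrite -[in RHS]ewt [RHS]mxE.
exists c; split=> //.
have Swt : S (w - t) by apply: (submodB sS Sw); exact: gen_in gt.
have other j : exists c', j != i0 -> (w - t) 0 j * a j = Psi c' /\ (size c' <= n + r)%N.
  have [->|ji0] := eqVneq j i0; first by exists 0.
  have [cj [wj cjn]] := bt j ji0; have [c' c'E] := Psi_right sp R_span (a j) cj.
  exists c' => _; rewrite wj; split=> //.
  by apply: leq_trans (fP j _ _ c'E) _; apply: leq_add cjn _; exact: leq_bigmax.
have [g gP] := choice other.
pose G : {poly K} := - \sum_(j | j != i0) g j.
have cE : Psi c * a i0 = Psi G.
  rewrite /G -sub0r PsiB Psi0 sub0r Psi_sum; apply/eqP; rewrite -addr_eq0; apply/eqP.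
  transitivity (\sum_j (w - t) 0 j * a j); last exact: Swt.
  rewrite [RHS](bigD1 i0) //=; congr (_ + _); first by rewrite -wc.
  by apply: eq_bigr => j /gP [].
have [cm|cm] := leqP (size c) m0; first by lia.
have := dP _ _ cE cm.
have : (size G <= n + r)%N.
  rewrite /G size_polyN; apply: leq_trans (size_sum _ _ _) _.
  by apply/bigmax_leqP => j /gP [].
by lia.
Qed.

Theorem shift_pair_coherent : left_coherent R.
Proof. by apply: coherent_of_syzygies => k a; exact: syzygy_fin_gen. Qed.

End Syzygies.

(** * An annihilator that is not finitely generated *)

Lemma size_shiftp_sub (K : fieldType) (p : {poly K}) :
  (size (shiftp 1 p - p)%R <= (size p).-1)%N.
Proof.
have s2 : size ('X + 1%:P : {poly K}) = 2 by rewrite size_XaddC.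
have sp : size (shiftp 1 p) = size p.
  by rewrite size_comp_poly2.
have [->|p0] := eqVneq p 0.
  by rewrite /shiftp comp_poly0 subrr size_poly0.
have p_gt0 : (0 < size p)%N by rewrite size_poly_gt0.
apply/leq_sizeP => i; rewrite leq_eqVlt => /orP [/eqP <-|pi].
  have := lead_coef_comp p (q := 'X + 1%:P); rewrite s2 => /(_ isT).
  rewrite lead_coefXaddC expr1n mulr1 /lead_coef sp coefB => ->.
  exact: subrr.
have ip : (size p <= i)%N by lia.
by rewrite coefB !nth_default ?subrr ?sp.
Qed.

Section NonCoherence.
Variables (K : fieldType) (R : pzRingType) (h : {rmorphism {poly K} -> R}).
Variables (D J t : R).
Hypothesis charK : [pchar K] =i pred0.
Hypothesis sp : shift_pair h D J.
Hypothesis R_span : spanned h D J (centralizes h D J).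
Hypothesis tC : centralizes h D J t.

Let diff (x : R) : R := D * x * J - x.

Let diffD x y : diff (x + y) = diff x + diff y.
Proof. by rewrite /diff mulrDr mulrDl opprD addrACA. Qed.

Let diff0 : diff 0 = 0.
Proof. by rewrite /diff mulr0 mul0r subrr. Qed.

Let diffMn x k : diff (x *+ k) = diff x *+ k.
Proof.
by elim: k => [|k IHk]; rewrite ?mulr0n ?diff0 // !mulrS diffD IHk.
Qed.

Let iter_diffD n x y : iter n diff (x + y) = iter n diff x + iter n diff y.
Proof. by elim: n => //= n ->; exact: diffD. Qed.

Let iter_diff0 n : iter n diff 0 = 0.
Proof. by elim: n => //= n ->; exact: diff0. Qed.

Let iter_diff_J n m x : iter n diff (x * J ^+ m) = iter n diff x * J ^+ m.
Proof.
elim: n => //= n ->; rewrite /diff mulrBl; congr (_ - _).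
by rewrite -!mulrA -exprSr exprS.
Qed.

Let iter_diff_le n m x : (n <= m)%N -> iter n diff x = 0 -> iter m diff x = 0.
Proof. by move=> nm x0; rewrite -(subnK nm) iterD x0 iter_diff0. Qed.

(** Conjugation by D and J shifts theta by 1, so [diff] acts on the coefficient
    as a finite difference. *)
Lemma diff_monomial p i c : centralizes h D J c ->
  diff (h p * J ^+ i * c) = h (shiftp 1 p - p) * J ^+ i * c.
Proof.
move=> [Dc Jc _]; rewrite /diff rmorphB !mulrBl; congr (_ - _).
rewrite !mulrA -[D]expr1 (Dn_h sp) expr1 -!mulrA -[c * J]Jc; congr (_ * _).
by rewrite !mulrA -[D * _ * _]mulrA -exprSr exprS !mulrA (sp_DJ sp) mul1r.
Qed.

(** Multiplying by a power of J clears the powers of D; finite differences then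
    lower the degree in theta. *)
Lemma diff_nilpotent b : exists n m, iter n diff (b * J ^+ m) = 0.
Proof.
elim/R_span: b => [a b [n [m am]] [n' [m' bm]]|i p j c cC].
  exists (n + n')%N, (m + m')%N; rewrite mulrDl iter_diffD.
  rewrite {1}exprD [(m + m')%N]addnC exprD !mulrA !(iter_diff_J _ _ (_ * _)).
  by rewrite (iter_diff_le _ am) ?leq_addr // (iter_diff_le _ bm) ?leq_addl // !mul0r addr0.
exists (size p), j.
have [Dc Jc hc] := cC.
have -> : J ^+ i * h p * D ^+ j * c * J ^+ j = h (shiftp (- i%:R) p) * J ^+ i * c.
  rewrite -[_ * c * _]mulrA [c * _](commrX _ (commr_sym Jc)) -!mulrA.
  by rewrite [D ^+ j * _]mulrA (DnJn sp) mul1r !mulrA (Jn_h sp).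
have : (size (shiftp (- i%:R) p) <= size p)%N.
  by rewrite size_comp_poly2 // size_XaddC.
elim: (size p) (shiftp _ _) => [|n IHn] q qn.
  by move: qn; rewrite size_poly_leq0 => /eqP ->; rewrite rmorph0 !mul0r.
rewrite iterSr diff_monomial // IHn //.
by apply: leq_trans (size_shiftp_sub q) _; lia.
Qed.

(** The ring contains the field [K] of characteristic zero. *)
Lemma natmul_eq0 (x : R) n : x *+ n.+1 = 0 -> x = 0.
Proof.
move=> xn; have n0 : n.+1%:R != 0 :> K by rewrite ((pcharf0P K).1 charK).
have <- : h (n.+1%:R^-1)%:P * (x *+ n.+1) = x; last by rewrite xn mulr0.
rewrite -(mulr_natl x) mulrA -[X in _ * X * _](rmorph_nat h) -rmorphM -polyC_natr.
by rewrite -polyCM mulVf // rmorph1 mul1r.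
Qed.

(** With Q_k the k-th difference of Q, the difference of x (theta - s) is
    diff(x) (theta - s) + diff(x) + x. Iterated on Q (theta - s) = 0 this gives
    Q_(k+1) (theta - s) + (k+1) (Q_(k+1) + Q_k) = 0, so that Q_(k+1) = 0 forces
    Q_k = 0. *)
Lemma diff_annihilator n s Q : centralizes h D J s ->
  iter n diff Q = 0 -> Q * (h 'X - s) = 0 -> Q = 0.
Proof.
move=> [Ds Js _] Qn Q0.
have hJ : (h 'X - s) * J = J * (h 'X - s) + J.
  rewrite mulrBl mulrBr -Js -[J in h _ * J]expr1 (h_Jn sp) expr1 /shiftp.
  by rewrite comp_polyX rmorphD rmorph1 mulrDr mulr1 addrAC.
have leibniz x : diff (x * (h 'X - s)) = diff x * (h 'X - s) + (diff x + x).
  rewrite {1}/diff -!mulrA hJ /diff subrK mulrBl mulrDr mulrDr !mulrA.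
  by rewrite addrAC.
have step k : iter k.+1 diff Q * (h 'X - s) +
    (iter k.+1 diff Q + iter k diff Q) *+ k.+1 = 0.
  elim: k => [|k IHk] /=; first by rewrite mulr1n -leibniz Q0 diff0.
  have := congr1 diff IHk; rewrite diff0 diffD leibniz diffMn diffD -/(iter _ _ _) => IH.
  by rewrite mulrS addrA -[RHS]IH.
elim: n Qn => // n IHn Qn; apply: IHn; apply: (@natmul_eq0 _ n).
by have := step n; rewrite Qn mul0r !add0r.
Qed.

(** Moving J^m across theta replaces [t] by t - m, and [diff_annihilator] applies to
    b J^m. *)
Lemma annihilator_J b : b * (h 'X - t) = 0 -> exists n, b * J ^+ n = 0.
Proof.
move=> b0; have [n [m bm]] := diff_nilpotent b; exists m.
have [Dt Jt ht] := tC.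
apply: (diff_annihilator (s := t - m%:R) _ bm).
  split=> [||p]; apply: commrB => //; exact: commr_nat.
rewrite opprB addrA -mulrA.
have -> : J ^+ m * (h 'X + m%:R - t) = (h 'X - t) * J ^+ m.
  rewrite mulrBr mulrBl (h_Jn sp) /shiftp comp_polyX rmorphD polyC_natr rmorph_nat.
  by congr (_ - _); apply: commr_sym; apply: commrX; apply: commr_sym.
by rewrite mulrA b0 mul0r.
Qed.

(** Finitely many elements of the annihilator are killed by a common power of J, and
    so is the left ideal that they generate. *)
Lemma not_coherent : (forall n, exists2 b, b * (h 'X - t) = 0 & b * J ^+ n <> 0) ->
  ~ left_coherent R.
Proof.
move=> large /annihilator_fin_gen /(_ (h 'X - t)) [l [lS lg]].
have [n lJ] : exists n, forall x, x \in l -> x * J ^+ n = 0.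
  elim: l lS {lg} => [|x l IHl] lS; first by exists 0%N.
  have [n nP] := IHl (fun y ly => lS y (mem_behead (s := x :: l) ly)).
  have [m xm] := annihilator_J (lS x (mem_head _ _)).
  exists (m + n)%N => y; rewrite inE => /orP [/eqP ->|/nP yn].
    by rewrite exprD mulrA xm mul0r.
  by rewrite addnC exprD mulrA yn mul0r.
have [b b0 bJ] := large n; apply: bJ.
have [y [gy /eqP]] := lg b b0; rewrite subr_eq0 => /eqP ->.
apply: (gen_in (S := fun x : R^o => x * J ^+ n = 0)) gy => //.
split; first by rewrite mul0r.
by move=> a u v u0 v0; rewrite mulrDl -[_ * _]mulrA u0 v0 mulr0 addr0.
Qed.

End NonCoherence.

Section TwoPairs.
Variables (K : fieldType) (R : pzRingType).
Variables (h1 h2 : {rmorphism {poly K} -> R}) (D1 J1 D2 J2 : R).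
Hypothesis charK : [pchar K] =i pred0.
Hypotheses (sp1 : shift_pair h1 D1 J1) (sp2 : shift_pair h2 D2 J2).
Hypothesis R_span : spanned h1 D1 J1 (centralizes h1 D1 J1).
Hypothesis D2C : centralizes h1 D1 J1 D2.
Hypothesis J2C : centralizes h1 D1 J1 J2.
Hypothesis h2C : forall p, centralizes h1 D1 J1 (h2 p).
Hypothesis e12 : (1 - J1 * D1) * (1 - J2 * D2) <> 0.

(** Both theta_1 and theta_2 act on e_1 D_1^n e_2 D_2^n from the right as
    multiplication by n. *)
Lemma two_pairs_not_coherent : ~ left_coherent R.
Proof.
apply: (not_coherent charK sp1 R_span (h2C 'X)) => n.
pose e1 := 1 - J1 * D1; pose e2 := 1 - J2 * D2.
pose f1 := e1 * D1 ^+ n; pose f2 := e2 * D2 ^+ n.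
have [[DD JD hD] [DJ JJ hJ]] := (D2C, J2C).
have e2C x : GRing.comm x D2 -> GRing.comm x J2 -> GRing.comm x e2.
  by move=> xD xJ; apply: commrB; [exact: commr1|exact: commrM].
have f2C x : GRing.comm x D2 -> GRing.comm x J2 -> GRing.comm x f2.
  by move=> xD xJ; apply: commrM; [exact: e2C|exact: commrX].
have f1t : f1 * h1 'X = n%:R * f1.
  by rewrite (eDn_h sp1) hornerX polyC_natr rmorph_nat.
have f2t : f2 * h2 'X = n%:R * f2.
  by rewrite (eDn_h sp2) hornerX polyC_natr rmorph_nat.
exists (f1 * f2).
  rewrite mulrBr -(mulrA f1 f2 (h1 'X)) -(f2C (h1 'X)) // mulrA f1t.
  by rewrite -(mulrA f1 f2) f2t mulrA [f1 * _]commr_nat subrr.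
move=> f0; apply: e12.
suff f20 : e1 * f2 = 0.
  have := congr1 (fun x => x * J2 ^+ n) f20.
  by rewrite mul0r /f2 -!mulrA (DnJn sp2) mulr1.
have J1f2 : GRing.comm f2 (J1 ^+ n).
  by apply: commrX; apply: commr_sym; apply: f2C.
by rewrite -f0 -(mulrA f1 f2) J1f2 (mulrA f1) -(mulrA e1 (D1 ^+ n)) (DnJn sp1) mulr1.
Qed.

End TwoPairs.

(** * Right coherence *)

Section Converse.
Variables (K : fieldType) (R : pzRingType) (h : {rmorphism {poly K} -> R}).
Variables (D J : R).

(** The same function is a ring morphism to the converse ring because polynomials
    commute. *)
Definition conv_morph (p : {poly K}) : R^c := h p.

Lemma conv_morph_additive : zmod_morphism conv_morph.
Proof. by move=> p q; exact: (rmorphB h). Qed.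
Lemma conv_morph_mul : monoid_morphism conv_morph.
Proof. by split=> [|p q]; [exact: (rmorph1 h)|rewrite /conv_morph mulrC; exact: (rmorphM h)]. Qed.

HB.instance Definition _ :=
  GRing.isZmodMorphism.Build {poly K} R^c conv_morph conv_morph_additive.
HB.instance Definition _ :=
  GRing.isMonoidMorphism.Build {poly K} R^c conv_morph conv_morph_mul.

Lemma centralizes_conv c :
  centralizes h D J c -> @centralizes K R^c conv_morph J D c.
Proof.
by case=> Dc Jc hc; split=> [||p]; [exact: esym Jc|exact: esym Dc|exact: esym (hc p)].
Qed.

Lemma shift_pair_conv :
  shift_pair h D J -> @shift_pair K R^c conv_morph J D.
Proof.
move=> sp; split.
- exact: sp_DJ sp.
- exact: sp_JD sp.
- move=> p; exact: sp_Jh sp p.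
- move=> p; exact: sp_hD sp p.
- move=> p; rewrite [LHS](sp_he sp p) -[RHS]/((1 - J * D) * h p.[0]%:P).
  by rewrite (sp_eh sp) hornerC.
- move=> p; rewrite [LHS](sp_eh sp p) -[RHS]/((1 - J * D) * h p.[0]%:P).
  by rewrite (sp_eh sp) hornerC.
Qed.

Lemma spanned_conv (C : R -> Prop) : (forall c, C c -> centralizes h D J c) ->
  spanned h D J C -> @spanned K R^c conv_morph J D C.
Proof.
move=> CC R_span P PD Pt; apply: R_span => // i p j c Cc.
have := Pt j p i c Cc; congr P.
have [Dc Jc hc] := CC c Cc; rewrite !revrX.
rewrite -[LHS]/(c * (J ^+ i * (h p * D ^+ j))).
rewrite !mulrA [c * _](commrX _ (commr_sym Jc)).
rewrite -[_ * c * _]mulrA -hc !mulrA -[_ * c * _]mulrA.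
by rewrite (commrX _ (commr_sym Dc)) !mulrA.
Qed.

End Converse.

Section RightCoherence.
Variables (K : fieldType) (R : pzRingType).
Hypothesis charK : [pchar K] =i pred0.

Lemma shift_pair_right_coherent (h : {rmorphism {poly K} -> R}) (D J : R) :
  shift_pair h D J -> spanned h D J (fun c => c = 1) -> right_coherent R.
Proof.
move=> sp R_span.
apply: (@shift_pair_coherent K R^c (conv_morph h) J D charK (shift_pair_conv sp)).
by apply: spanned_conv R_span => c ->; split=> *; exact: commr1.
Qed.

Lemma two_pairs_not_right_coherent (h1 h2 : {rmorphism {poly K} -> R})
    (D1 J1 D2 J2 : R) :
  shift_pair h1 D1 J1 -> shift_pair h2 D2 J2 ->
  spanned h1 D1 J1 (centralizes h1 D1 J1) ->
  centralizes h1 D1 J1 D2 -> centralizes h1 D1 J1 J2 ->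
  (forall p, centralizes h1 D1 J1 (h2 p)) ->
  (1 - J1 * D1) * (1 - J2 * D2) <> 0 -> ~ right_coherent R.
Proof.
move=> sp1 sp2 R_span D2C J2C h2C e12.
apply: (@two_pairs_not_coherent K R^c (conv_morph h1) (conv_morph h2) J1 D1 J2 D2
  charK (shift_pair_conv sp1) (shift_pair_conv sp2)).
- move=> P PD Pt; apply: (spanned_conv _ R_span) => // k p l c.
  by move=> /centralizes_conv; exact: Pt.
- exact: (centralizes_conv J2C).
- exact: (centralizes_conv D2C).
- by move=> p; exact: (centralizes_conv (h2C p)).
- have [Dd Jd _] := D2C; have [Dj Jj _] := J2C.
  have e2C x : GRing.comm x D2 -> GRing.comm x J2 -> GRing.comm x (1 - J2 * D2).
    by move=> xD xJ; apply: commrB; [exact: commr1|exact: commrM].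
  have e21 : GRing.comm (1 - J2 * D2) (1 - J1 * D1).
    by apply: commrB; [exact: commr1|apply: commrM; apply: commr_sym; exact: e2C].
  by rewrite -[_ * _]/((1 - J2 * D2) * (1 - J1 * D1)) e21.
Qed.

End RightCoherence.

(** * The algebras of integro-differential operators *)

Section WeylRelations.
Variables (K : fieldType) (A : algType K) (x d s : A).
Hypotheses (ds1 : d * s = 1) (dx : d * x = x * d + 1) (sdx : s * (d * x) = x).
Hypothesis sd1 : s * d != 1.

Local Notation theta := (x * d).

Let theta_d : theta * d = d * (theta - 1).
Proof. by rewrite mulrBr mulr1 mulrA dx mulrDl mul1r addrK. Qed.

Let s_theta : s * theta = (theta - 1) * s.
Proof.
rewrite mulrBl mul1r -[theta * s]mulrA ds1 mulr1.
by apply/eqP; rewrite eq_sym subr_eq -{2}[s]mulr1 -mulrDr -dx sdx.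
Qed.

Let e_theta : (1 - s * d) * theta = 0.
Proof. by rewrite mulrBl mul1r !mulrA -[s * d * x]mulrA sdx subrr. Qed.

Let theta_e : theta * (1 - s * d) = 0.
Proof. by rewrite -mulrA mulrBr mulr1 mulrA ds1 mul1r subrr mulr0. Qed.

Let shift_ind (p : {poly K}) c :
  horner_alg theta (shiftp (-1) (p * 'X + c%:P)) =
  horner_alg theta (shiftp (-1) p) * (theta - 1) + c%:A.
Proof.
rewrite /shiftp comp_polyD comp_polyM comp_polyX comp_polyC.
by rewrite !rmorphD rmorphM rmorphD /= !horner_algC horner_algX scaleN1r.
Qed.

Let horner_algMXD (p : {poly K}) c :
  horner_alg theta (p * 'X + c%:P) = horner_alg theta p * theta + c%:A.
Proof. by rewrite rmorphD rmorphM /= horner_algC horner_algX. Qed.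

(** The three relations between x, d and s determine how theta = x d commutes with d
    and s; the rules for p(theta) follow by induction on p. *)
Lemma weyl_shift_pair : shift_pair (horner_alg theta) d s.
Proof.
split=> //.
- elim/poly_ind => [|p c IHp]; first by rewrite /shiftp comp_poly0 !rmorph0 mulr0 mul0r.
  rewrite horner_algMXD shift_ind mulrDl mulrDr -mulrA theta_d mulrA IHp mulrA.
  by rewrite mulr_algl mulr_algr.
- elim/poly_ind => [|p c IHp]; first by rewrite /shiftp comp_poly0 !rmorph0 mulr0 mul0r.
  rewrite horner_algMXD shift_ind mulrDl mulrDr mulrA IHp -mulrA s_theta mulrA.
  by rewrite mulr_algl mulr_algr.
- elim/poly_ind => [|p c IHp]; first by rewrite horner0 !rmorph0 mulr0 mul0r.
  rewrite horner_algMXD mulrDr mulrA IHp -mulrA e_theta mulr0 add0r.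
  by rewrite !hornerE horner_algC mulr_algl mulr_algr.
- elim/poly_ind => [|p c IHp]; first by rewrite horner0 !rmorph0 mul0r.
  rewrite horner_algMXD mulrDl -mulrA theta_e mulr0 add0r.
  by rewrite !hornerE horner_algC.
Qed.

End WeylRelations.

Section SubalgGenInd.
Variables (K : comNzRingType) (A : algType K) (G : A -> Prop).

(** The elements of the generated subalgebra satisfying [P] form a subalgebra of [A]. *)
Lemma subalg_gen_ind (P : subalg_gen_type G -> Prop) :
  P 1 -> (forall (k : K) a b, P a -> P b -> P (k *: a + b)) ->
  (forall a b, P a -> P b -> P (a * b)) ->
  (forall a, G (val a) -> P a) -> forall a, P a.
Proof.
move=> P1 PL PM PG a.
pose S : {pred A} := fun f => `[< exists a, val a = f /\ P a >].
have S_closed : subalg_closed S.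
  split=> [|k u v|u v].
  - by apply/asboolP; exists 1.
  - move=> /asboolP [b [<- Pb]] /asboolP [c [<- Pc]]; apply/asboolP.
    by exists (k *: b + c); split; last exact: PL.
  - move=> /asboolP [b [<- Pb]] /asboolP [c [<- Pc]]; apply/asboolP.
    by exists (b * c); split; last exact: PM.
pose SM := GRing.isSubalgClosed.Build K A S S_closed.
pose SC : subalgClosed A := HB.pack S SM.
have genG f : G f -> f \in subalg_gen G.
  by move=> Gf; apply/asboolP => T; apply.
have /asboolP /(_ SC) genS := valP a.
suff : val a \in SC by move=> /asboolP [b [/val_inj <-]].
apply: genS => f Gf.
by apply/asboolP; exists (Sub f (genG f Gf)); split=> //; apply: PG.
Qed.

End SubalgGenInd.

Section Concrete.
Variables (K : fieldType) (n : nat).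
Hypothesis charK : [pchar K] =i pred0.
Implicit Types (i j : 'I_n) (f g : polyEnd K n).

Lemma polyEnd_eqX f g : (forall m, f 'X_[m] = g 'X_[m]) -> f = g.
Proof.
move=> fin_gen; apply/polyEndP => p; rewrite /polyEnd_fun [p]mpolyE !linear_sum.
by apply: eq_bigr => m _; rewrite !linearZ; congr (_ *: _); exact: fin_gen.
Qed.

Lemma II_generator_mem f : II_generator f -> f \in subalg_gen (@II_generator K n).
Proof. by move=> Gf; apply/asboolP => T; apply. Qed.

Lemma II_generator_x i : II_generator (op_x K i).
Proof. by exists i; constructor. Qed.
Lemma II_generator_d i : II_generator (op_d K i).
Proof. by exists i; constructor. Qed.
Lemma II_generator_int i : II_generator (op_int K i).
Proof. by exists i; constructor. Qed.

Definition II_x i : II K n := Sub (op_x K i) (II_generator_mem (II_generator_x i)).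
Definition II_d i : II K n := Sub (op_d K i) (II_generator_mem (II_generator_d i)).
Definition II_int i : II K n := Sub (op_int K i) (II_generator_mem (II_generator_int i)).

(** A linear operator is determined by its values on monomials. *)
Lemma II_eqX (a b : II K n) :
  (forall m, val a 'X_[m] = val b 'X_[m]) -> a = b.
Proof. by move=> ab; apply/val_inj/polyEnd_eqX. Qed.

Lemma natS_neq0 k : k.+1%:R != 0 :> K.
Proof. by rewrite ((pcharf0P K).1 charK). Qed.

Lemma II_xE i m : val (II_x i) 'X_[m] = 'X_[U_(i) + m].
Proof. by rewrite mpolyXD. Qed.

Lemma II_dE i m : val (II_d i) 'X_[m] = (m i)%:R *: 'X_[m - U_(i)].
Proof. exact: mderivX. Qed.

Lemma II_intE i m : val (II_int i) 'X_[m] = (m i).+1%:R^-1 *: 'X_[U_(i) + m].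
Proof. by rewrite mpolyXD -mpoly_intX. Qed.

Lemma II_valM (a b : II K n) p : val (a * b) p = val a (val b p).
Proof. by []. Qed.

Lemma II_valZ (a : II K n) c p : val a (c *: p) = c *: val a p.
Proof. exact: linearZ. Qed.

Lemma II_d_int i : II_d i * II_int i = 1.
Proof.
apply/II_eqX => m; rewrite II_valM II_intE II_valZ II_dE mnmDE mnm1E eqxx scalerA.
rewrite mulVf ?natS_neq0 // scale1r; congr 'X_[_].
by rewrite mnmP => j; rewrite mnmBE mnmDE addKn.
Qed.

Lemma II_d_x i : II_d i * II_x i = II_x i * II_d i + 1.
Proof.
apply/val_inj/polyEndP => p; rewrite /= /polyEnd_fun /=.
rewrite /mpoly_mulX mderivM mderivX mnm1E eqxx scale1r addrC.
by rewrite (_ : U_(i) - U_(i) = 0)%MM ?mpolyX0 ?mul1r // mnmP => j; rewrite mnmBE subnn mnm0E.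
Qed.

Lemma II_int_d_x i : II_int i * (II_d i * II_x i) = II_x i.
Proof.
apply/II_eqX => m; rewrite !II_valM II_xE II_dE II_valZ mnmDE mnm1E eqxx.
have -> : (U_(i) + m - U_(i) = m)%MM by rewrite mnmP => j; rewrite mnmBE mnmDE addKn.
by rewrite II_intE scalerA mulfV ?natS_neq0 // scale1r.
Qed.

Lemma II_d_one i : val (II_d i) 1 = 0.
Proof. by rewrite -mpolyX0 II_dE mnm0E scale0r. Qed.

Lemma II_idem_one i : val (1 - II_int i * II_d i) 1 = 1.
Proof.
rewrite -[LHS]/(1 - val (II_int i) (val (II_d i) 1)) II_d_one.
by rewrite -(scale0r 1) II_valZ scale0r subr0.
Qed.

Lemma II_int_d_neq1 i : II_int i * II_d i != 1.
Proof.
apply/eqP => sd1; have := II_idem_one i; rewrite sd1 subrr => /esym /eqP.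
by rewrite oner_eq0.
Qed.

Definition II_theta i : {rmorphism {poly K} -> II K n} := horner_alg (II_x i * II_d i).

Lemma II_shift_pair i : shift_pair (II_theta i) (II_d i) (II_int i).
Proof. exact: weyl_shift_pair (II_d_int i) (II_d_x i) (II_int_d_x i) (II_int_d_neq1 i). Qed.

Section Commute.
Variables i j : 'I_n.
Hypothesis ij : i != j.

Lemma mnm1_neq : (U_(i)%MM : 'X_{1..n}) j = 0%N.
Proof. by rewrite mnm1E (negPf ij). Qed.

Lemma II_comm_xx : GRing.comm (II_x i) (II_x j).
Proof. by apply/II_eqX => m; rewrite !II_valM !II_xE !addmA [(U_(i) + _)%MM]addmC. Qed.

Lemma II_comm_xd : GRing.comm (II_x i) (II_d j).
Proof.
apply/val_inj/polyEndP => p; rewrite /= /polyEnd_fun /=.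
by rewrite /mpoly_mulX mderivM mderivX mnm1_neq scale0r mul0r add0r.
Qed.

Lemma II_comm_xint : GRing.comm (II_x i) (II_int j).
Proof.
apply/II_eqX => m; rewrite !II_valM II_intE II_valZ !II_xE II_intE mnmDE mnm1_neq add0n.
by rewrite !addmA [(U_(i) + _)%MM]addmC.
Qed.

Lemma II_comm_dd : GRing.comm (II_d i) (II_d j).
Proof. by apply/val_inj/polyEndP => p; exact: mderiv_comm. Qed.

Lemma II_comm_intint : GRing.comm (II_int i) (II_int j).
Proof.
apply/II_eqX => m; rewrite !II_valM !II_intE !II_valZ !II_intE !mnmDE mnm1_neq mnm1E.
rewrite eq_sym (negPf ij) !add0n !scalerA mulrC.
by rewrite !addmA [(U_(i) + _)%MM]addmC.
Qed.

Lemma II_comm_intd : GRing.comm (II_int i) (II_d j).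
Proof.
apply/II_eqX => m; rewrite !II_valM II_intE II_valZ !II_dE II_valZ II_intE mnmDE mnm1_neq add0n !scalerA.
rewrite mnmBE mnm1E [j == i]eq_sym (negPf ij) subn0 mulrC.
have [->|mj] := eqVneq (m j) 0%N; first by rewrite mulr0 !scale0r.
congr (_ *: 'X_[_]); rewrite mnmP => k; rewrite !(mnmBE, mnmDE) !mnm1E.
by have [<-|] := eqVneq j k; rewrite ?(negPf ij); lia.
Qed.

End Commute.

Lemma horner_alg_comm (A : algType K) (t c : A) p :
  GRing.comm t c -> GRing.comm (horner_alg t p) c.
Proof.
move=> tc; elim/poly_ind: p => [|p k IHp]; first by rewrite rmorph0; exact/commr_sym/commr0.
rewrite rmorphD rmorphM /= horner_algC horner_algX.
apply/commr_sym/commrD; first by apply: commrM; exact: commr_sym.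
by rewrite /GRing.comm mulr_algl mulr_algr.
Qed.

Lemma II_centralizes i c : GRing.comm (II_x i) c -> GRing.comm (II_d i) c ->
  GRing.comm (II_int i) c -> centralizes (II_theta i) (II_d i) (II_int i) c.
Proof.
move=> xc dc sc; split=> // p; apply: horner_alg_comm.
by apply/commr_sym/commrM; exact: commr_sym.
Qed.

Lemma II_centralizes_gen i j c : i != j -> [\/ c = II_x j, c = II_d j | c = II_int j] ->
  centralizes (II_theta i) (II_d i) (II_int i) c.
Proof.
move=> ij; have ji : j != i by rewrite eq_sym.
case=> ->; apply: II_centralizes.
- exact: II_comm_xx.
- exact/commr_sym/II_comm_xd.
- exact/commr_sym/II_comm_xint.
- exact: II_comm_xd.
- exact: II_comm_dd.
- exact: II_comm_intd.
- exact: II_comm_xint.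
- exact/commr_sym/II_comm_intd.
- exact: II_comm_intint.
Qed.

(** The span is stable under right multiplication by theta, D, J and the elements of
    [C], hence by x = theta J and by all the generators; it contains 1. Stability
    under right multiplication, unlike membership, passes to products. *)
Lemma II_spanned i (C : II K n -> Prop) : C 1 ->
  (forall a b, C a -> C b -> C (a * b)) ->
  (forall c, C c -> centralizes (II_theta i) (II_d i) (II_int i) c) ->
  (forall j c, i != j -> [\/ c = II_x j, c = II_d j | c = II_int j] -> C c) ->
  spanned (II_theta i) (II_d i) (II_int i) C.
Proof.
move=> C1 CM CC Cgen; set D := II_d i; set J := II_int i; set h := II_theta i.
have sp := II_shift_pair i.
pose T (a : II K n) := forall P : II K n -> Prop,
  (forall a b, P a -> P b -> P (a + b)) ->
  (forall k p l c, C c -> P (J ^+ k * h p * D ^+ l * c)) -> P a.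
suff allT : forall a, T a by move=> P PD Pt a; exact: (allT a P PD Pt).
have TD a b : T a -> T b -> T (a + b).
  by move=> Ta Tb P PD Pt; exact: PD (Ta P PD Pt) (Tb P PD Pt).
have Tt k p l c : C c -> T (J ^+ k * h p * D ^+ l * c).
  by move=> Cc P _ Pt; exact: Pt.
have hC c : h c%:P = c%:A by exact: horner_algC.
have TZ c a : T a -> T (c *: a).
  move=> Ta; apply: (Ta (fun a => T (c *: a))) => [u v|k p l b Cb].
    by rewrite scalerDr; exact: TD.
  have -> : c *: (J ^+ k * h p * D ^+ l * b) = J ^+ k * h (c *: p) * D ^+ l * b.
    by rewrite -mul_polyC rmorphM hC mulr_algl -scalerAr -!scalerAl.
  exact: Tt.
pose Q (g : II K n) := forall a, T a -> T (a * g).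
have Qterm (g : II K n) : (forall k p l c, C c -> T (J ^+ k * h p * D ^+ l * c * g)) -> Q g.
  move=> Tg a Ta; apply: (Ta (fun a => T (a * g))) => // u v.
  by rewrite mulrDl; exact: TD.
have QM a b : Q a -> Q b -> Q (a * b).
  by move=> Qa Qb u Tu; rewrite mulrA; exact: Qb _ (Qa _ Tu).
have QC c : C c -> Q c.
  move=> Cc; apply: Qterm => k p l b Cb; rewrite -mulrA; apply: Tt; exact: CM.
have QD : Q D.
  apply: Qterm => k p l c Cc; have [Dc _ _] := CC c Cc.
  by rewrite -mulrA -Dc mulrA -[_ * D ^+ l * D]mulrA -exprSr; exact: Tt.
have QJ : Q J.
  apply: Qterm => k p l c Cc; have [_ Jc _] := CC c Cc.
  rewrite -mulrA -Jc mulrA; case: l => [|l]; last first.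
    by rewrite -[_ * D ^+ _ * J]mulrA exprSr -[D ^+ l * D * J]mulrA (sp_DJ sp) mulr1; exact: Tt.
  rewrite expr0 mulr1 -[_ * h p * J]mulrA -[J in h p * J]expr1 (h_Jn sp) expr1 mulrA -exprSr.
  by rewrite -[_ * h _]mulr1 -(expr0 D); exact: Tt.
have Qh q : Q (h q).
  apply: Qterm => k p l c Cc; have [_ _ hc] := CC c Cc.
  by rewrite -(mulrA _ c) -hc mulrA (monomial_h sp k p l q); exact: Tt.
have QX : Q (II_x i).
  have -> : II_x i = h 'X * J by rewrite /h /II_theta /= horner_algX -mulrA II_d_int mulr1.
  exact: QM.
move=> a; suff Qa : Q a.
  have T1 : T 1 by have := Tt 0%N 1 0%N 1 C1; rewrite !expr0 rmorph1 !mulr1.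
  by have := Qa 1 T1; rewrite mul1r.
elim/subalg_gen_ind: a => [|c a b Qa Qb|a b|a [j Ga]].
- by move=> a; rewrite mulr1.
- move=> u Tu; rewrite mulrDr -scalerAr; apply: TD; last exact: Qb.
  exact: TZ _ _ (Qa _ Tu).
- exact: QM.
- have {}Ga : [\/ a = II_x j, a = II_d j | a = II_int j].
    by case: Ga => aE; [constructor 1|constructor 2|constructor 3]; exact: val_inj.
  have [ij|ij] := eqVneq i j; last exact: QC _ (Cgen j _ ij Ga).
  by rewrite -ij in Ga; case: Ga => ->.
Qed.

End Concrete.

Section Main.
Variables (K : fieldType).
Hypothesis charK : [pchar K] =i pred0.

(** The scalars are already among the p(theta). *)
Lemma II1_spanned (i : 'I_1) :
  spanned (II_theta K i) (II_d K i) (II_int K i) (fun c => c = 1).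
Proof.
apply: (II_spanned charK) => //.
- by move=> a b -> ->; rewrite mulr1.
- by move=> c ->; split=> *; exact: commr1.
- by move=> j c; rewrite !ord1.
Qed.

Lemma II_spanned_centralizer n (i : 'I_n) :
  spanned (II_theta K i) (II_d K i) (II_int K i) (centralizes (II_theta K i) (II_d K i) (II_int K i)).
Proof.
apply: (II_spanned charK) => //.
- by split=> *; exact: commr1.
- move=> a b [Da Ja ha] [Db Jb hb].
  by split=> [||p]; apply: commrM.
- by move=> j c; exact: II_centralizes_gen.
Qed.

Lemma II1_left_coherent : left_coherent (II K 1).
Proof.
exact: shift_pair_coherent charK (II_shift_pair charK ord0) (@II1_spanned ord0).
Qed.

Lemma II1_right_coherent : right_coherent (II K 1).
Proof.
exact (shift_pair_right_coherent charK (II_shift_pair charK ord0) (@II1_spanned ord0)).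
Qed.

Section Several.
Variable n : nat.
Hypothesis n_gt1 : (1 < n)%N.
Let i1 : 'I_n := Ordinal (ltnW n_gt1).
Let i2 : 'I_n := Ordinal n_gt1.

Let C2 c : [\/ c = II_x K i2, c = II_d K i2 | c = II_int K i2] ->
  centralizes (II_theta K i1) (II_d K i1) (II_int K i1) c.
Proof. exact: II_centralizes_gen. Qed.

Let h2C p : centralizes (II_theta K i1) (II_d K i1) (II_int K i1) (II_theta K i2 p).
Proof.
have [Dx Jx hx] := C2 (Or31 _ _ erefl); have [Dd Jd hd] := C2 (Or32 _ _ erefl).
split=> [||q]; apply: commr_sym; apply: horner_alg_comm; apply: commr_sym; exact: commrM.
Qed.

Let e12 : val ((1 - II_int K i1 * II_d K i1) * (1 - II_int K i2 * II_d K i2)) 1 <> 0.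
Proof.
by rewrite II_valM !II_idem_one; apply/eqP; exact: oner_neq0.
Qed.

Let e12_neq0 : (1 - II_int K i1 * II_d K i1) * (1 - II_int K i2 * II_d K i2) <> 0.
Proof. by move=> e0; apply: e12; rewrite e0. Qed.

Lemma II_not_left_coherent : ~ left_coherent (II K n).
Proof.
exact: two_pairs_not_coherent charK (II_shift_pair charK i1)
  (II_shift_pair charK i2) (@II_spanned_centralizer _ i1)
  (C2 (Or32 _ _ erefl)) (C2 (Or33 _ _ erefl)) h2C e12_neq0.
Qed.

Lemma II_not_right_coherent : ~ right_coherent (II K n).
Proof.
exact (two_pairs_not_right_coherent charK (II_shift_pair charK i1)
  (II_shift_pair charK i2) (@II_spanned_centralizer _ i1)
  (C2 (Or32 _ _ erefl)) (C2 (Or33 _ _ erefl)) h2C e12_neq0).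
Qed.

End Several.
End Main.

Theorem theorem3p1 (K : fieldType) (n : nat)
    (charK : [pchar K] =i pred0) (n_ge1 : (1 <= n)%N) :
  [<-> left_coherent (II K n); right_coherent (II K n); n = 1%N].
Proof.
have n1 : n <> 1%N -> (1 < n)%N by lia.
tfae.
- move=> Lcoh; have [->|/n1 n_gt1] := pselect (n = 1%N).
    exact: II1_right_coherent.
  by case: (II_not_left_coherent charK n_gt1 Lcoh).
- move=> Rcoh; have [//|/n1 n_gt1] := pselect (n = 1%N).
  by case: (II_not_right_coherent charK n_gt1 Rcoh).
- by move=> ->; exact: II1_left_coherent.
Qed.
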